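(* Let $S$ be a compact connected Riemann surface of genus $g\ge 2$, let $G\le \mathrm{Aut}(S)$, and let $L$ be a theta characteristic on $S$ that is invariant under $G$. Let $(g_0;c_1,\dots,c_r)$ be the signature of the action of $G$ on $S$. Write each $c_i=2^{a_i}b_i$ with $a_i\in\mathbb{Z}_{\ge 0}$ and $b_i\in\mathbb{Z}_{\ge 1}$ odd, and let $A=\max_i a_i$. Suppose that 1. $G$ is perfect, i.e. $[G,G]=G$; 2. $|H^2(G,\mathbb{C}^\times)|=2$; 3. $g_0=0$; 4. $A\neq 0$ and the number $|\{i : a_i=A\}|$ is odd. Then $L$ is even, i.e. $\dim_{\mathbb{C}} H^0(S,L)$ is even.
   Context: $\mathrm{Aut}(S)$ is the (finite) group of holomorphic automorphisms of $S$. A theta characteristic on $S$ is a (holomorphic) line bundle $L\to S$ with $L^{\otimes 2}\cong K_S$, where $K_S$ is the canonical bundle; it is invariant under $G\le\mathrm{Aut}(S)$ if $h^*L\cong L$ for every $h\in G$. Its parity is $\dim_{\mathbb{C}} H^0(S,L)\bmod 2$; it is even if this is $0$. The signature of the action of $G$ on $S$ is the tuple $(g_0;c_1,\dots,c_r)$, where $g_0$ is the genus of the quotient $S/G$, $Q_1,\dots,Q_r$ are the branch points of the quotient map $\pi:S\to S/G$, and $c_i\in\mathbb{Z}_{>1}$ is the order of the isotropy group in $G$ of any point $P_i\in\pi^{-1}(Q_i)$. $H^2(G,\mathbb{C}^\times)$ is the Schur multiplier of $G$ (group cohomology with trivial action on $\mathbb{C}^\times$). *)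

(* Defs.v *)
From HB Require Import structures.
From mathcomp Require Export all_boot all_order all_algebra.
From mathcomp Require Export all_classical all_reals all_analysis.
From mathcomp.real_closed Require Export complex.

Set Implicit Arguments.
Unset Strict Implicit.
Unset Printing Implicit Defensive.

Import Order.TTheory GRing.Theory Num.Theory numFieldNormedType.Exports.

Local Open Scope classical_set_scope.
Local Open Scope ring_scope.
Local Open Scope complex_scope.
Local Open Scope card_scope.

(* MathComp-Analysis puts the topology and normed-module structure of the
   field R[i] on its regular algebra (R[i])^o; both are the same type. *)
Notation Cplx R := (R[i]^o).

(** * Riemann surfaces *)

(* Only the values of chart_map on chart_dom and of chart_inv on the image
   chart_map @` chart_dom are meaningful. *)
Record chart (R : realType) (X : topologicalType) := Chart {
  chart_dom : set X;
  chart_map :> X -> Cplx R;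
  chart_inv : Cplx R -> X;
  chart_dom_open : open chart_dom;
  chart_codom_open : open (chart_map @` chart_dom);
  chart_mapK : {in chart_dom, cancel chart_map chart_inv};
  chart_map_continuous : {in chart_dom, continuous chart_map};
  chart_inv_continuous : {in chart_map @` chart_dom, continuous chart_inv}
}.

(* Holomorphy is complex differentiability at every point of an open set:
   derivable _ z 1 over the field R[i]. Connectedness and compactness are not
   included and are stated where needed. *)
Record riemannSurface (R : realType) := RiemannSurface {
  rs_space :> topologicalType;
  rs_index : Type;
  rs_chart : rs_index -> chart R rs_space;
  rs_hausdorff : hausdorff_space rs_space;
  rs_cover : forall x, exists i, chart_dom (rs_chart i) x;
  rs_compatible : forall i j x,
    chart_dom (rs_chart i) x -> chart_dom (rs_chart j) x ->
    derivable (rs_chart j \o chart_inv (rs_chart i) : Cplx R -> Cplx R)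
      (rs_chart i x) 1
}.

Definition holomorphic_on (R : realType) (S : riemannSurface R) (U : set S)
    (f : S -> Cplx R) : Prop :=
  forall (i : rs_index S) (x : S), U x -> chart_dom (rs_chart i) x ->
    derivable (f \o chart_inv (rs_chart i) : Cplx R -> Cplx R)
      (rs_chart i x) 1.

Definition holomorphic_map (R : realType) (S T : riemannSurface R)
    (f : S -> T) : Prop :=
  continuous f /\
  forall (i : rs_index S) (j : rs_index T) (x : S),
    chart_dom (rs_chart i) x -> chart_dom (rs_chart j) (f x) ->
    derivable
      (rs_chart j \o f \o chart_inv (rs_chart i) : Cplx R -> Cplx R)
      (rs_chart i x) 1.

Definition automorphism (R : realType) (S : riemannSurface R)
    (f : S -> S) : Prop :=
  holomorphic_map f /\
  exists f' : S -> S, [/\ cancel f f', cancel f' f & holomorphic_map f'].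

(** * Holomorphic line bundles *)

(* A line bundle is presented by its transition functions g_ij with respect
   to local trivialisations over an open cover (U_i); the values of g_ij
   outside the overlap of U_i and U_j are irrelevant. A section is a family
   (s_i) with s_i = g_ij s_j on that overlap. *)
Record bundle (R : realType) (S : riemannSurface R) := Bundle {
  lb_index : Type;
  lb_dom : lb_index -> set S;
  lb_trans : lb_index -> lb_index -> S -> Cplx R
}.
Arguments lb_dom {R S} b i _ : rename.
Arguments lb_trans {R S} b i j _ : rename.

Definition holomorphic_line_bundle (R : realType) (S : riemannSurface R)
    (L : bundle S) : Prop :=
  [/\ forall i, open (lb_dom L i),
      forall x, exists i, lb_dom L i x,
      forall i j, holomorphic_on (lb_dom L i `&` lb_dom L j) (lb_trans L i j),
      forall i j x, lb_dom L i x -> lb_dom L j x -> lb_trans L i j x != 0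
    & forall i j k x, lb_dom L i x -> lb_dom L j x -> lb_dom L k x ->
        lb_trans L i j x * lb_trans L j k x = lb_trans L i k x].

(* In the trivialisations, an isomorphism L -> L' is multiplication by
   nowhere zero holomorphic functions: s'_j = lam_ij s_i on the overlap of
   U_i and U'_j. *)
Definition bundle_iso (R : realType) (S : riemannSurface R)
    (L L' : bundle S) : Prop :=
  exists lam : lb_index L -> lb_index L' -> S -> Cplx R,
    [/\ forall i j, holomorphic_on (lb_dom L i `&` lb_dom L' j) (lam i j),
        forall i j x, lb_dom L i x -> lb_dom L' j x -> lam i j x != 0
      & forall i k j l x,
          lb_dom L i x -> lb_dom L k x -> lb_dom L' j x -> lb_dom L' l x ->
          lb_trans L' l j x * lam i j x = lam k l x * lb_trans L k i x].

Definition bundle_square (R : realType) (S : riemannSurface R)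
    (L : bundle S) : bundle S :=
  Bundle (lb_dom L) (fun i j x => lb_trans L i j x ^+ 2).

Definition bundle_pullback (R : realType) (S : riemannSurface R)
    (h : S -> S) (L : bundle S) : bundle S :=
  Bundle (fun i => h @^-1` lb_dom L i) (fun i j x => lb_trans L i j (h x)).

(* The local section s_i stands for the form s_i dz_i, where z_i is the i-th
   chart, so that g_ij = dz_j / dz_i. *)
Definition canonical_bundle (R : realType) (S : riemannSurface R) : bundle S :=
  Bundle (fun i : rs_index S => chart_dom (rs_chart i))
    (fun i j x =>
       derive1 (rs_chart j \o chart_inv (rs_chart i) : R[i] -> Cplx R)
         (rs_chart i x)).

(* H^0(S, L); requiring s_i to vanish outside U_i makes the total function
   s_i determined by its restriction to U_i. *)
Definition sections (R : realType) (S : riemannSurface R) (L : bundle S) :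
    set (lb_index L -> S -> Cplx R) :=
  [set s | [/\ forall i, holomorphic_on (lb_dom L i) (s i),
               forall i j x, lb_dom L i x -> lb_dom L j x ->
                 s i x = lb_trans L i j x * s j x
             & forall i x, ~ lb_dom L i x -> s i x = 0]].
Arguments sections {R S} L _.

(* A, a linear subspace of V, has finite dimension n. *)
Definition has_dim (K : fieldType) (V : lmodType K) (A : set V) (n : nat) :
    Prop :=
  exists e : 'I_n -> V,
    [/\ forall k, A (e k),
        forall a : 'I_n -> K, \sum_k a k *: e k = 0 -> forall k, a k = 0
      & forall v, A v -> exists a : 'I_n -> K, v = \sum_k a k *: e k].

Definition dim_H0 (R : realType) (S : riemannSurface R) (L : bundle S)
    (n : nat) : Prop :=
  has_dim (V := (lb_index L -> S -> Cplx R : lmodType R[i])) (sections L) n.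

(* For compact connected surfaces: the dimension of the space of holomorphic
   differentials. *)
Definition genus (R : realType) (S : riemannSurface R) (g : nat) : Prop :=
  dim_H0 (canonical_bundle S) g.

Definition theta_characteristic (R : realType) (S : riemannSurface R)
    (L : bundle S) : Prop :=
  holomorphic_line_bundle L /\
  bundle_iso (bundle_square L) (canonical_bundle S).

Definition even_theta (R : realType) (S : riemannSurface R) (L : bundle S) :
    Prop :=
  exists2 n, dim_H0 L n & ~~ odd n.

(** * Groups of automorphisms *)

(* The subgroup G of Aut(S) is given as an abstract group with an injective
   homomorphism rho to Aut(S). *)
Definition aut_subgroup (R : realType) (S : riemannSurface R) (G : groupType)
    (rho : G -> S -> S) : Prop :=
  [/\ forall h, automorphism (rho h),
      forall h k, rho (h * k)%g = rho h \o rho k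
    & injective rho].

Definition invariant_bundle (R : realType) (S : riemannSurface R)
    (G : groupType) (rho : G -> S -> S) (L : bundle S) : Prop :=
  forall h, bundle_iso (bundle_pullback (rho h) L) L.

(* T with pi is the quotient S/G as a Riemann surface: this determines
   (T, pi) up to a unique isomorphism. *)
Definition is_quotient (R : realType) (S T : riemannSurface R)
    (G : groupType) (rho : G -> S -> S) (pi : S -> T) : Prop :=
  [/\ holomorphic_map pi,
      forall y, exists x, pi x = y
    & forall x y, pi x = pi y <-> exists h, rho h x = y].

Definition ramification_point (X Y : topologicalType) (f : X -> Y) (x : X) :
    Prop :=
  ~ exists2 U : set X, nbhs x U & {in U &, injective f}.

Definition branch_points (X Y : topologicalType) (f : X -> Y) : set Y :=
  f @` [set x | ramification_point f x].

Definition isotropy (X : Type) (G : groupType) (rho : G -> X -> X) (x : X) :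
    set G :=
  [set h | rho h x = x].

(* (g0; c_0, ..., c_(r-1)) is the signature of the action of G on S, where pi
   is the quotient map from S to S/G = T. *)
Definition is_signature (R : realType) (S T : riemannSurface R)
    (G : groupType) (rho : G -> S -> S) (pi : S -> T)
    (g0 r : nat) (c : 'I_r -> nat) : Prop :=
  genus T g0 /\
  exists Q : 'I_r -> T,
    [/\ injective Q,
        range Q = branch_points pi,
        forall i, (1 < c i)%N
      & forall i x, pi x = Q i -> isotropy rho x #= `I_(c i)].

(** * Perfect groups and the Schur multiplier *)

(* The library's derived subgroup is only available for finite groups. *)
Definition derived_subgroup (G : groupType) : set G :=
  [set x | forall H : {pred G}, group_closed H ->
     (forall y z, [~ y, z]%g \in H) -> x \in H].
Arguments derived_subgroup G _ : clear implicits.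

Definition perfect (G : groupType) : Prop := derived_subgroup G = [set: G].

Definition cocycle2 (K : fieldType) (G : groupType) : set (G -> G -> K) :=
  [set f | (forall x y, f x y != 0) /\
     forall x y z, f x y * f (x * y)%g z = f y z * f x (y * z)%g].
Arguments cocycle2 K G _ : clear implicits.

Definition cohomologous2 (K : fieldType) (G : groupType)
    (f f' : G -> G -> K) : Prop :=
  exists b : G -> K, (forall x, b x != 0) /\
    forall x y, f' x y = f x y * (b x * b y / b (x * y)%g).

(* H^2(G, K^x) with trivial action, as the set of cohomology classes. *)
Definition H2 (K : fieldType) (G : groupType) : set (set (G -> G -> K)) :=
  [set [set f' | cocycle2 K G f' /\ cohomologous2 f f'] | f in cocycle2 K G].
Arguments H2 K G _ : clear implicits.

(* Main.v *)
Require Import Defs.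
From mathcomp Require Import zify ring lra.

Import Order.TTheory GRing.Theory Num.Theory numFieldNormedType.Exports.

Set Implicit Arguments.
Unset Strict Implicit.
Unset Printing Implicit Defensive.

Local Open Scope classical_set_scope.
Local Open Scope ring_scope.
Local Open Scope complex_scope.
Local Open Scope card_scope.

(** The sections of L carry a representation of G up to sign, and its
    determinant decides the parity of the dimension.

    Call an isomorphism h^*L -> L normalised when its square is the natural
    action of h on K_S = L^2 ([root_lift]). Every h in G has such a lift: the
    square of an arbitrary isomorphism h^*L -> L differs from the natural
    action by a nowhere zero holomorphic function, which is constant on a
    compact connected surface, and a square root of this constant is absorbed
    in the isomorphism ([root_lift_exists]). Two normalised lifts of h differ
    by a sign ([root_lift_unique]), and normalised lifts compose
    ([root_lift_comp]). So if M_h is the matrix by which a normalised lift of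
    h acts on H^0(S, L), then h |-> det(M_h)^2 is a well defined homomorphism
    from G to the multiplicative group of a field. It is trivial because G is
    perfect.

    Since A is not 0, some isotropy group has even order and contains an
    involution h, which fixes a point P. The derivative of h at P is -1
    ([involution_tangent]), so a normalised lift of h multiplies the fibre of
    L at P by a number of square -1; its square, which is a normalised lift of
    the identity, is therefore -1 everywhere, and M_h^2 = -1. With n the
    dimension of H^0(S, L) this gives 1 = det(M_h)^2 = (-1)^n, so n is even
    ([perfect_lift_even]). The dimension is finite because multiplication by a
    fixed nonzero section of L embeds H^0(S, L) in H^0(S, K_S)
    ([sections_has_dim]).

    Holomorphy being complex differentiability at each point, the function
    theory starts with Goursat's lemma. Integrals are replaced by trapezoidal
    sums over dyadic subdivisions ([trapezoid], [boundary_sum]): the sums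
    around the cells of a grid telescope to the sum around the rectangle, and
    they vanish on affine functions, so the bisection argument shows that they
    tend to 0 ([goursat]). Applied to f(p + e^w) on a rectangle of height
    2 pi, this says that the means of f on a circle about p tend to f(p), even
    if f is merely continuous at p itself ([circle_mean]). The maximum
    principle thus holds for functions with isolated exceptional points, in
    particular for difference quotients of holomorphic functions. The bounds
    that it gives for iterated difference quotients yield the identity theorem
    ([identity_disc]), the holomorphy of derivatives ([derivative_cdif]), and
    the fact that a local involution with derivative 1 is the identity
    ([involution_id]). *)

Local Notation re := (@complex.Re _).
Local Notation im := (@complex.Im _).
Local Notation cn := (@ComplexField.Normc.normc _).

(** * Moduli and complex differentiability *)

Section Modulus.
Variable R : realType.
Local Notation C := R[i].
Implicit Types z w : C.

Lemma norm_cn z : `|z| = (cn z)%:C. Proof. by case: z. Qed.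

Lemma cn_ge0 z : 0 <= cn z.
Proof. by rewrite -ler0c -norm_cn. Qed.

Lemma cn0 : cn (0 : C) = 0. Proof. exact: ComplexField.Normc.normc0. Qed.

Lemma cn1 : cn (1 : C) = 1. Proof. exact: ComplexField.Normc.normc1. Qed.

Lemma cn_eq0 z : (cn z == 0) = (z == 0).
Proof. by rewrite -[LHS](inj_eq (@complexI R)) -norm_cn normr_eq0. Qed.

Lemma cn_gt0 z : (0 < cn z) = (z != 0).
Proof. by rewrite lt_neqAle cn_ge0 andbT eq_sym cn_eq0. Qed.

Lemma cnM z w : cn (z * w) = cn z * cn w.
Proof. exact: ComplexField.Normc.normcM. Qed.

Lemma cnV z : cn z^-1 = (cn z)^-1.
Proof. exact: ComplexField.Normc.normcV. Qed.

Lemma cnX z n : cn (z ^+ n) = cn z ^+ n.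
Proof. by elim: n => [|n IH]; rewrite ?cn1 // !exprS cnM IH. Qed.

Lemma cnN z : cn (- z) = cn z. Proof. exact: normcN. Qed.

Lemma cnBC z w : cn (z - w) = cn (w - z).
Proof. by rewrite -cnN opprB. Qed.

Lemma cnD z w : cn (z + w) <= cn z + cn w. Proof. exact: le_normcD. Qed.

Lemma cnB z w : cn (z - w) <= cn z + cn w.
Proof. by rewrite -(cnN w) cnD. Qed.

Lemma cn_lerB z w : cn z - cn w <= cn (z - w).
Proof. by rewrite lerBlDr; apply: le_trans (cnD _ _); rewrite subrK. Qed.

Lemma cn_trans z w v : cn (z - v) <= cn (z - w) + cn (w - v).
Proof. by apply: le_trans (cnD _ _); rewrite addrA subrK. Qed.

Lemma cn_real (x : R) : cn x%:C = `|x|.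
Proof. by rewrite /= expr0n /= addr0 sqrtr_sqr. Qed.

Lemma cn_i : cn ('i%C : C) = 1.
Proof. by rewrite /= expr0n expr1n /= add0r sqrtr1. Qed.

Lemma cn_natr n : cn (n%:R : C) = n%:R.
Proof. by rewrite -(rmorph_nat (real_complex R)) cn_real normr_nat. Qed.

Lemma re_le_cn z : `|re z| <= cn z.
Proof. by have := normc_ge_Re z; rewrite norm_cn lecR. Qed.

Lemma im_le_cn z : `|im z| <= cn z.
Proof.
by have := re_le_cn (z * 'i%C); rewrite cnM cn_i mulr1 ReiNIm normrN.
Qed.

Lemma reD z w : re (z + w) = re z + re w. Proof. by case: z w => ? ? []. Qed.

Lemma imD z w : im (z + w) = im z + im w. Proof. by case: z w => ? ? []. Qed.

Lemma reB z w : re (z - w) = re z - re w. Proof. by case: z w => ? ? []. Qed.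

Lemma imB z w : im (z - w) = im z - im w. Proof. by case: z w => ? ? []. Qed.

Lemma reZ (x : R) z : re (x%:C * z) = x * re z.
Proof. by case: z => a b /=; rewrite mul0r subr0. Qed.

Lemma cn_reim z : z = re z +i* im z. Proof. by case: z. Qed.

Lemma cn_le_reim z : cn z <= `|re z| + `|im z|.
Proof.
rewrite {1}[z]complexE.
by apply: le_trans (cnD _ _) _; rewrite cnM cn_i mul1r !cn_real.
Qed.

Lemma sqr_cn z : cn z ^+ 2 = re z ^+ 2 + im z ^+ 2.
Proof. by case: z => a b /=; rewrite sqr_sqrtr // addr_ge0 // sqr_ge0. Qed.

Lemma cn_re_eq z : cn z <= 1 -> 1 <= re z -> z = 1.
Proof.
move=> z1 r1; have := sqr_cn z => e.
have h : cn z ^+ 2 <= 1 by rewrite expr_le1 ?cn_ge0.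
have ? : im z = 0 by apply/eqP; rewrite -sqrf_eq0; apply/eqP; nra.
rewrite (cn_reim z); congr Complex => //; nra.
Qed.

(** Continuity and differentiability with real moduli, so that estimates stay in
    the ordered field R: the norm of the library takes its values in R[i]. *)
Definition cont_at (f : C -> C) z := forall e : R, 0 < e ->
  exists2 d : R, 0 < d & forall w, cn (w - z) < d -> cn (f w - f z) <= e.

Definition cdif (f : C -> C) z c := forall e : R, 0 < e ->
  exists2 d : R, 0 < d &
  forall w, cn (w - z) < d -> cn (f w - f z - c * (w - z)) <= e * cn (w - z).

End Modulus.

(** * Trapezoidal sums on edges and around rectangles *)

Section Edges.
Variable R : realType.
Local Notation C := R[i].

(** The trapezoidal rule for phi on [a, a + s] with 2 ^ n equal steps. The
    recursion on halves makes additivity under bisection definitional. *)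
Fixpoint trapezoid (n : nat) (phi : R -> C) (a s : R) : C :=
  if n is n'.+1 then
    trapezoid n' phi a (s / 2) + trapezoid n' phi (a + s / 2) (s / 2)
  else s%:C * (phi a + phi (a + s)) / 2.

Lemma trapezoid_lin n (u : C) phi psi a s :
  trapezoid n (fun y => u * phi y + psi y) a s = u * trapezoid n phi a s + trapezoid n psi a s.
Proof.
elim: n a s => [|n IH] a s /=; first by field.
by rewrite !IH; ring.
Qed.

Lemma trapezoid_scale n (u : C) phi a s :
  trapezoid n (fun y => u * phi y) a s = u * trapezoid n phi a s.
Proof.
elim: n a s => [|n IH] a s /=; first by field.
by rewrite !IH; ring.
Qed.

(** The rule with one step is already exact on affine functions, so further
    bisection does not change it. *)
Lemma trapezoid_affine n (u v : C) a s :
  trapezoid n (fun y => u + v * y%:C) a s =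
  s%:C * (u + v * a%:C + (u + v * (a + s)%:C)) / 2.
Proof.
elim: n a s => [|n IH] a s //=.
rewrite !IH.
have -> : a + s / 2 + s / 2 = a + s by field.
rewrite !rmorphD /= !rmorphM /= fmorphV /= rmorph_nat; by field.
Qed.

Lemma trapezoid_const n (u : C) a s : trapezoid n (fun=> u) a s = s%:C * u.
Proof.
elim: n a s => [|n IH] a s /=; first by field.
by rewrite !IH !rmorphM /= fmorphV /= rmorph_nat; by field.
Qed.

Lemma trapezoid_bound n phi a s (M : R) : 0 <= s ->
  (forall y, a <= y <= a + s -> cn (phi y) <= M) ->
  cn (trapezoid n phi a s) <= s * M.
Proof.
elim: n a s => [|n IH] a s s0 h /=.
  rewrite !cnM cnV cn_natr cn_real (ger0_norm s0) -mulrA ler_wpM2l //.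
  rewrite ler_pdivrMr //; apply: le_trans (cnD _ _) _.
  by rewrite mulrDr mulr1 lerD //; apply: h; lra.
apply: le_trans (cnD _ _) _.
have -> : s * M = s / 2 * M + s / 2 * M by field.
by apply: lerD; apply: IH; rewrite ?divr_ge0 // => y hy; apply: h; lra.
Qed.

Lemma trapezoid_re_le n phi a s : 0 <= s ->
  (forall y, a <= y <= a + s -> re (phi y) <= 1) -> re (trapezoid n phi a s) <= s.
Proof.
elim: n a s => [|n IH] a s s0 h /=.
  have -> : s%:C * (phi a + phi (a + s)) / 2 =
            (s / 2)%:C * (phi a + phi (a + s)).
    by rewrite rmorphM /= fmorphV /= rmorph_nat; ring.
  rewrite reZ reD.
  have h1 : re (phi a) <= 1 by apply: h; lra.
  have h2 : re (phi (a + s)) <= 1 by apply: h; lra.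
  nra.
rewrite reD.
have h1 : re (trapezoid n phi a (s / 2)) <= s / 2.
  by apply: IH; rewrite ?divr_ge0 // => y hy; apply: h; lra.
have h2 : re (trapezoid n phi (a + s / 2) (s / 2)) <= s / 2.
  by apply: IH; rewrite ?divr_ge0 // => y hy; apply: h; lra.
lra.
Qed.

(** Once the mesh is fine enough, a whole dyadic interval of length s / 2 ^ m lies
    where phi is small, and this keeps the means away from 1. *)
Lemma trapezoid_re_lt m phi a s (eta y0 : R) : 0 <= s -> a <= y0 <= a + s ->
  (forall y, a <= y <= a + s -> re (phi y) <= 1) ->
  (forall y, a <= y <= a + s -> `|y - y0| <= s / 2 ^+ m ->
     re (phi y) <= 1 - eta) ->
  forall n, (m <= n)%N -> re (trapezoid n phi a s) <= s - eta * s / 2 ^+ m.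
Proof.
elim: m a s => [|m IH] a s s0 hy0 h1 h2 n.
  move=> _; rewrite expr0 divr1.
  have : 0 <= eta \/ eta < 0 by lra.
  pose psi y := phi y + eta%:C.
  have -> : trapezoid n phi a s = trapezoid n psi a s - s%:C * eta%:C.
    have -> : psi = (fun y => 1 * phi y + eta%:C).
      by apply/funext => y; rewrite /psi mul1r.
    by rewrite (trapezoid_lin n 1 phi (fun=> eta%:C)) trapezoid_const; ring.
  rewrite reB reZ /= => _.
  suff : re (trapezoid n psi a s) <= s by lra.
  apply: trapezoid_re_le => // y hy; rewrite reD /=.
  suff : re (phi y) <= 1 - eta by lra.
  by apply: h2 => //; rewrite expr0 divr1 ler_norml; lra.
case: n => // n mn /=; rewrite reD.
have e2 : s / 2 ^+ m.+1 = s / 2 / 2 ^+ m by rewrite exprS invfM mulrA.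
have s2 : 0 <= s / 2 by lra.
have [c|c] : y0 <= a + s / 2 \/ a + s / 2 <= y0 by lra.
  have : re (trapezoid n phi a (s / 2)) <= s / 2 - eta * (s / 2) / 2 ^+ m.
    apply: IH => //; first by lra.
      by move=> y hy; apply: h1; lra.
    by move=> y hy hy2; apply: h2; [lra | rewrite e2].
  have : re (trapezoid n phi (a + s / 2) (s / 2)) <= s / 2.
    by apply: trapezoid_re_le => // y hy; apply: h1; lra.
  rewrite -[X in _ -> _ -> _ <= _ - X]mulrA e2 -[eta * (s / 2) / _]mulrA; lra.
have : re (trapezoid n phi (a + s / 2) (s / 2)) <= s / 2 - eta * (s / 2) / 2 ^+ m.
  apply: IH => //; first by lra.
    by move=> y hy; apply: h1; lra.
  by move=> y hy hy2; apply: h2; [lra | rewrite e2].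
have : re (trapezoid n phi a (s / 2)) <= s / 2.
  by apply: trapezoid_re_le => // y hy; apply: h1; lra.
rewrite -[X in _ -> _ -> _ <= _ - X]mulrA e2 -[eta * (s / 2) / _]mulrA; lra.
Qed.

Definition pt (x y : R) : C := x%:C + 'i%C * y%:C.

Lemma re_pt x y : re (pt x y) = x.
Proof. by rewrite /= mul0r mul1r; simpl; ring. Qed.

Lemma im_pt x y : im (pt x y) = y.
Proof. by rewrite /= mul0r mul1r; simpl; ring. Qed.

Lemma pt_reim z : z = pt (re z) (im z). Proof. exact: complexE. Qed.

(** The trapezoidal sum of F dz around the rectangle [x, x + s] x [y, y + t],
    counterclockwise. *)
Definition boundary_sum n (F : C -> C) (x y s t : R) : C :=
  trapezoid n (fun u => F (pt u y)) x s
  + 'i%C * trapezoid n (fun v => F (pt (x + s) v)) y t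
  - trapezoid n (fun u => F (pt u (y + t))) x s
  - 'i%C * trapezoid n (fun v => F (pt x v)) y t.

(** Contributions of the inner edges cancel. *)
Lemma boundary_sum_split n F x y s t : boundary_sum n.+1 F x y s t =
  boundary_sum n F x y (s / 2) (t / 2) + boundary_sum n F (x + s / 2) y (s / 2) (t / 2)
  + (boundary_sum n F x (y + t / 2) (s / 2) (t / 2)
  + boundary_sum n F (x + s / 2) (y + t / 2) (s / 2) (t / 2)).
Proof.
rewrite /boundary_sum /=.
have -> : x + s / 2 + s / 2 = x + s by field.
have -> : y + t / 2 + t / 2 = y + t by field.
ring.
Qed.

Lemma boundary_sum_lin n (F G : C -> C) x y s t :
  boundary_sum n (fun z => F z + G z) x y s t = boundary_sum n F x y s t + boundary_sum n G x y s t.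
Proof.
have e phi psi a r : trapezoid n (fun y => phi y + psi y) a r =
    trapezoid n phi a r + trapezoid n psi a r.
  rewrite -[trapezoid n phi a r in RHS]mul1r -trapezoid_lin.
  by congr (trapezoid n _ a r); apply/funext => v; rewrite mul1r.
by rewrite /boundary_sum !e; ring.
Qed.

Lemma boundary_sum_affine n (u v : C) x y s t :
  boundary_sum n (fun z => u + v * z) x y s t = 0.
Proof.
have e1 r a q : trapezoid n (fun w => u + v * pt w r) a q =
    q%:C * (u + v * pt a r + (u + v * pt (a + q) r)) / 2.
  have -> : (fun w => u + v * pt w r) =
            (fun w : R => u + v * (r%:C * 'i%C) + v * w%:C).
    by apply/funext => w; rewrite /pt; ring.
  by rewrite trapezoid_affine /pt; ring.
have e2 r a q : trapezoid n (fun w => u + v * pt r w) a q =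
    q%:C * (u + v * pt r a + (u + v * pt r (a + q))) / 2.
  have -> : (fun w => u + v * pt r w) =
            (fun w : R => u + v * r%:C + (v * 'i%C) * w%:C).
    by apply/funext => w; rewrite /pt; ring.
  by rewrite trapezoid_affine /pt; ring.
rewrite /boundary_sum !e1 !e2 /pt !rmorphD /=; by field.
Qed.

Lemma boundary_sum_bound n F x y s t (M : R) : 0 <= s -> 0 <= t ->
  (forall z, x <= re z <= x + s -> y <= im z <= y + t -> cn (F z) <= M) ->
  cn (boundary_sum n F x y s t) <= 2 * (s + t) * M.
Proof.
move=> s0 t0 h; rewrite /boundary_sum.
apply: le_trans (cnB _ _) _; rewrite cnM cn_i mul1r.
have b1 a phi r : 0 <= r -> (forall v, a <= v <= a + r -> cn (phi v) <= M) ->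
  cn (trapezoid n phi a r) <= r * M by move=> ? ?; apply: trapezoid_bound.
have h1 : cn (trapezoid n (fun v => F (pt x v)) y t) <= t * M.
  by apply: b1 => // v hv; apply: h => //; rewrite ?re_pt ?im_pt; lra.
have h2 : cn (trapezoid n (fun u => F (pt u (y + t))) x s) <= s * M.
  by apply: b1 => // v hv; apply: h => //; rewrite ?re_pt ?im_pt; lra.
have h3 : cn ('i%C * trapezoid n (fun v => F (pt (x + s) v)) y t) <= t * M.
  rewrite cnM cn_i mul1r.
  by apply: b1 => // v hv; apply: h => //; rewrite ?re_pt ?im_pt; lra.
have h4 : cn (trapezoid n (fun u => F (pt u y)) x s) <= s * M.
  by apply: b1 => // v hv; apply: h => //; rewrite ?re_pt ?im_pt; lra.
have := cnB (trapezoid n (fun u => F (pt u y)) x s +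
    'i%C * trapezoid n (fun v => F (pt (x + s) v)) y t)
  (trapezoid n (fun u => F (pt u (y + t))) x s).
have := cnD (trapezoid n (fun u => F (pt u y)) x s)
  ('i%C * trapezoid n (fun v => F (pt (x + s) v)) y t).
lra.
Qed.

End Edges.

(** * Goursat's lemma *)

Lemma halving_lt (R : realType) (s d : R) : 0 <= s -> 0 < d ->
  exists k, s / 2 ^+ k < d.
Proof.
move=> s0 d0; exists (Num.bound (s / d)).
rewrite ltr_pdivrMr ?exprn_gt0 // mulrC -ltr_pdivrMr //.
have /archi_boundP b : 0 <= s / d by rewrite divr_ge0 // ltW.
by apply: (lt_trans b); rewrite -natrX ltr_nat ltn_expl.
Qed.

Section Goursat.
Variable R : realType.
Local Notation C := R[i].
Variables (F : C -> C) (eps : R).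

(** The rectangle q = ((x, y), (s, t)) satisfies the estimate that bisection
    propagates: the bound scales by 1 / 4 when the sides are halved, so four
    small quarters make a small rectangle. *)
Definition boundary_sum_small (q : R * R * (R * R)) :=
  exists N, forall n, (N <= n)%N ->
    cn (boundary_sum n F q.1.1 q.1.2 q.2.1 q.2.2) <= eps * (q.2.1 + q.2.2) ^+ 2.

Definition subrect (b c : bool) (q : R * R * (R * R)) : R * R * (R * R) :=
  ((q.1.1 + (if b then q.2.1 / 2 else 0), q.1.2 + (if c then q.2.2 / 2 else 0)),
   (q.2.1 / 2, q.2.2 / 2)).

Lemma boundary_sum_small_sub q :
  (forall b c, boundary_sum_small (subrect b c q)) -> boundary_sum_small q.
Proof.
case: q => [[x y] [s t]] h.
have [N1 h1] := h false false; have [N2 h2] := h true false.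
have [N3 h3] := h false true; have [N4 h4] := h true true.
exists (N1 + N2 + N3 + N4).+1 => -[//|n]; rewrite ltnS => hn.
move: (h1 n) (h2 n) (h3 n) (h4 n); rewrite /subrect /= !addr0 boundary_sum_split.
have -> : (N1 <= n)%N by lia. have -> : (N2 <= n)%N by lia.
have -> : (N3 <= n)%N by lia. have -> : (N4 <= n)%N by lia.
have -> : s / 2 + t / 2 = (s + t) / 2 by field.
have -> : eps * ((s + t) / 2) ^+ 2 = eps * (s + t) ^+ 2 / 4 by field.
move=> /(_ isT) b1 /(_ isT) b2 /(_ isT) b3 /(_ isT) b4.
apply: le_trans (cnD _ _) _.
apply: le_trans (lerD (cnD _ _) (cnD _ _)) _.
lra.
Qed.

Definition next_rect q :=
  if `[< boundary_sum_small (subrect false false q) >] then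
  if `[< boundary_sum_small (subrect true false q) >] then
  if `[< boundary_sum_small (subrect false true q) >] then subrect true true q
  else subrect false true q else subrect true false q else subrect false false q.

Lemma next_rectP q : exists b c, next_rect q = subrect b c q.
Proof.
rewrite /next_rect; case: ifP => _; last by exists false, false.
case: ifP => _; last by exists true, false.
by case: ifP => _; [exists true, true | exists false, true].
Qed.

Lemma next_rect_big q : ~ boundary_sum_small q -> ~ boundary_sum_small (next_rect q).
Proof.
move=> nq; rewrite /next_rect.
case: asboolP => // h1; case: asboolP => // h2; case: asboolP => // h3.
by move=> h4; apply: nq; apply: boundary_sum_small_sub => -[] [].
Qed.

Variables (x y s t : R).
Hypotheses (s0 : 0 < s) (t0 : 0 < t) (eps0 : 0 < eps).
Hypothesis Fd : forall z, x <= re z <= x + s -> y <= im z <= y + t ->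
  exists c, cdif F z c.

Let q0 : R * R * (R * R) := ((x, y), (s, t)).
Let rect k := iter k next_rect q0.

Lemma rect_size k : (rect k).2 = (s / 2 ^+ k, t / 2 ^+ k).
Proof.
elim: k => [|k IH]; first by rewrite /= !expr0 !divr1.
rewrite /rect /= -/(rect k); have [b [c ->]] := next_rectP (rect k).
by rewrite /subrect IH /= !exprS !invfM !mulrA -!(mulrAC _ (2 ^+ k)^-1).
Qed.

Lemma rect_corner k m :
  [/\ (rect k).1.1 <= (rect (m + k)).1.1,
      (rect (m + k)).1.1 + s / 2 ^+ (m + k) <= (rect k).1.1 + s / 2 ^+ k,
      (rect k).1.2 <= (rect (m + k)).1.2 &
      (rect (m + k)).1.2 + t / 2 ^+ (m + k) <= (rect k).1.2 + t / 2 ^+ k].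
Proof.
elim: m => [|m [h1 h2 h3 h4]]; first by rewrite !add0n !lexx.
rewrite addSn /rect /= -/(rect (m + k)).
have [b [c ->]] := next_rectP (rect (m + k)).
rewrite /subrect /= rect_size /= exprS invfM.
have p : 0 < (2 ^+ (m + k))^-1 :> R by rewrite invr_gt0 exprn_gt0.
have sp : 0 < s / 2 ^+ (m + k) by rewrite mulr_gt0.
have tp : 0 < t / 2 ^+ (m + k) by rewrite mulr_gt0.
rewrite !(mulrCA _ 2^-1) !(mulrC 2^-1).
by case: b; case: c; split; lra.
Qed.

Let X := sup [set (rect k).1.1 | k in setT].
Let Y := sup [set (rect k).1.2 | k in setT].

Lemma rect_limit k : (rect k).1.1 <= X <= (rect k).1.1 + s / 2 ^+ k
                  /\ (rect k).1.2 <= Y <= (rect k).1.2 + t / 2 ^+ k.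
Proof.
have p j : 0 < (2 ^+ j)^-1 :> R by rewrite invr_gt0 exprn_gt0.
have ubx j i : (rect j).1.1 <= (rect i).1.1 + s / 2 ^+ i.
  have [h1 h2 _ _] := rect_corner i j; have [h3 h4 _ _] := rect_corner j i.
  rewrite addnC in h1 h2; have := p (i + j)%N; move: h1 h2 h3 h4.
  have : 0 < s / 2 ^+ (i + j) by rewrite mulr_gt0.
  by lra.
have uby j i : (rect j).1.2 <= (rect i).1.2 + t / 2 ^+ i.
  have [_ _ h1 h2] := rect_corner i j; have [_ _ h3 h4] := rect_corner j i.
  rewrite addnC in h1 h2; have := p (i + j)%N; move: h1 h2 h3 h4.
  have : 0 < t / 2 ^+ (i + j) by rewrite mulr_gt0.
  by lra.
split; apply/andP; split.
  apply: ub_le_sup; last by exists k.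
  by exists ((rect k).1.1 + s / 2 ^+ k) => _ [j _ <-].
  by apply: ge_sup; [exists (rect k).1.1, k | move=> _ [j _ <-]].
  apply: ub_le_sup; last by exists k.
  by exists ((rect k).1.2 + t / 2 ^+ k) => _ [j _ <-].
  by apply: ge_sup; [exists (rect k).1.2, k | move=> _ [j _ <-]].
Qed.

(** A rectangle whose boundary sums are not small has such a quarter, and nested
    bad rectangles shrink to a point. Differentiability there contradicts badness,
    because the affine part of F contributes nothing. *)
Lemma goursat : boundary_sum_small q0.
Proof.
apply: contrapT => nsm.
have big k : ~ boundary_sum_small (rect k) by elim: k => // k /next_rect_big.
have [/=] := rect_limit 0; rewrite !expr0 !divr1 => hX hY.
have [||c /(_ (eps / 2)) [|d d0 hd]] := Fd (z := pt X Y).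
  by rewrite re_pt.
  by rewrite im_pt.
  by rewrite divr_gt0.
have [k hk] := halving_lt (addr_ge0 (ltW s0) (ltW t0)) d0.
have := big k; apply; exists 0%N => n _.
have [hXk hYk] := rect_limit k.
rewrite rect_size /=.
set sk := s / _; set tk := t / _.
have sk0 : 0 < sk by rewrite divr_gt0 ?exprn_gt0.
have tk0 : 0 < tk by rewrite divr_gt0 ?exprn_gt0.
rewrite -/sk in hXk; rewrite -/tk in hYk.
have skd : sk + tk < d by rewrite -mulrDl.
pose E z := F z - F (pt X Y) - c * (z - pt X Y).
pose A z := F (pt X Y) - c * pt X Y + c * z.
have -> : F = (fun z => E z + A z) by apply/funext => z; rewrite /E /A; ring.
rewrite boundary_sum_lin boundary_sum_affine addr0.
have -> : eps * (sk + tk) ^+ 2 = 2 * (sk + tk) * (eps / 2 * (sk + tk)) by field.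
apply: boundary_sum_bound; try exact: ltW.
move=> z hz1 hz2.
have dz : cn (z - pt X Y) <= sk + tk.
  apply: le_trans (cn_le_reim _) _; rewrite reB imB re_pt im_pt.
  by apply: lerD; rewrite ler_norml; lra.
apply: le_trans (hd _ (le_lt_trans dz skd)) _.
by rewrite ler_wpM2l // divr_ge0 // ltW.
Qed.

End Goursat.

(** * Calculus of complex differentiability and the exponential *)

Lemma derivable_eps (K : numFieldType) (f : K^o -> K^o) (z : K^o) :
  derivable f z 1 -> forall e : K, 0 < e -> exists2 d : K, 0 < d &
  forall w, `|w - z| < d ->
    `|f w - f z - derive1 f z * (w - z)| <= e * `|w - z|.
Proof.
move=> /derivable_nbhs /eqaddoP h e e0; have := h e e0.
rewrite near_simpl => /nbhs_normP[d /= d0 hd]; exists d => // w hw.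
have := hd (w - z); rewrite /= sub0r normrN => /(_ hw).
rewrite !fctE /= scaler1 subrK derive1E.
by rewrite opprD addrA [_ *: _]mulrC.
Qed.

Lemma eps_derivable (K : numFieldType) (f : K^o -> K^o) (z c : K^o) :
  (forall e : K, 0 < e -> exists2 d : K, 0 < d &
  forall w, `|w - z| < d -> `|f w - f z - c * (w - z)| <= e * `|w - z|) ->
  derivable f z 1 /\ derive1 f z = c.
Proof.
move=> h.
suff : is_derive z 1 f c by move=> [? <-]; rewrite derive1E.
suff : (fun h => h^-1 *: ((f \o shift z) (h *: 1) - f z)) @ 0^' --> c.
  move=> H; have D : derivable f z 1 by apply/cvg_ex; exists c.
  by apply: DeriveDef => //; apply: cvg_lim.
apply/cvgrPdist_le => e e0; have [d d0 hd] := h e e0.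
rewrite near_withinE; apply/nbhs_normP; exists d => // w /=.
rewrite sub0r normrN => hw w0.
have := hd (w + z); rewrite addrK => /(_ hw).
rewrite -ler_pdivrMr ?normr_gt0 // -normf_div distrC; apply: le_trans.
have -> : f (w + z) - f z - c * w = (w^-1 * (f (w + z) - f z) - c) * w.
  by rewrite mulrBl mulrAC mulVf // mul1r.
by rewrite mulfK // scaler1.
Qed.

Section Cdif.
Variable R : realType.
Local Notation C := R[i].

Lemma derivable_cdif (f : Cplx R -> Cplx R) z :
  derivable f z 1 -> cdif f z (derive1 f z).
Proof.
move=> df e e0.
have [|d d0 hd] := derivable_eps df (e := e%:C); first by rewrite ltcR.
have rd : d = (re d)%:C by move: d0; rewrite ltcE => /andP[/eqP]; case: (d) => ? ? /= ->.
exists (re d) => [|w hw]; first by rewrite -ltcR -rd.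
have := hd w; rewrite !norm_cn rd ltcR => /(_ hw).
by rewrite -rmorphM lecR.
Qed.

Lemma cdif_derivable (f : Cplx R -> Cplx R) z c :
  cdif f z c -> derivable f z 1 /\ derive1 f z = c.
Proof.
move=> df; apply: eps_derivable => e e0.
have re0 : e = (re e)%:C by move: e0; rewrite ltcE => /andP[/eqP]; case: (e) => ? ? /= ->.
have [|d d0 hd] := df (re e); first by rewrite -ltcR -re0.
exists d%:C => [|w]; first by rewrite ltcR.
by rewrite !norm_cn ltcR => /hd; rewrite re0 -rmorphM lecR.
Qed.

Lemma is_derive_eps (f : R -> R) (x d : R) : is_derive x 1 f d ->
  forall e : R, 0 < e -> exists2 dl : R, 0 < dl &
  forall h, `|h| < dl -> `|f (x + h) - f x - d * h| <= e * `|h|.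
Proof.
move=> [df <-] e e0.
have [dl dl0 hd] := @derivable_eps R f x df e e0.
exists dl => // h hh; have := hd (x + h).
by rewrite -derive1E addrAC subrr add0r => /(_ hh).
Qed.

Lemma cdif_cont (f : C -> C) z c : cdif f z c -> cont_at f z.
Proof.
move=> df e e0; have [d d0 hd] := df 1 ltr01.
have c1 : 0 < cn c + 1 by rewrite ltr_wpDl ?cn_ge0.
exists (Num.min d (e / (cn c + 1))) => [|w].
  by rewrite lt_min d0 divr_gt0.
rewrite lt_min => /andP[/hd h1]; rewrite ltr_pdivlMr // => h2.
have -> : f w - f z = f w - f z - c * (w - z) + c * (w - z) by ring.
apply: le_trans (cnD _ _) _; rewrite cnM.
move: h1 h2; set n := cn (w - z); lra.
Qed.

Lemma cdif_comp (f g : C -> C) z c d :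
  cdif f z c -> cdif g (f z) d -> cdif (fun w => g (f w)) z (d * c).
Proof.
move=> df dg e e0.
have d1 : 0 < cn d + 1 by rewrite ltr_wpDl ?cn_ge0.
have c1 : 0 < cn c + 1 by rewrite ltr_wpDl ?cn_ge0.
have [|r r0 h1] := df (Num.min 1 (e / 2 / (cn d + 1))).
  by rewrite lt_min ltr01 !divr_gt0.
have [|q q0 h2] := dg (e / 2 / (cn c + 1)); first by rewrite !divr_gt0.
exists (Num.min r (q / (cn c + 1))) => [|w]; first by rewrite lt_min r0 divr_gt0.
rewrite lt_min => /andP[/h1 E]; rewrite ltr_pdivlMr // => hq.
have [] : cn (f w - f z - c * (w - z)) <= cn (w - z) /\
  cn (f w - f z - c * (w - z)) <= e / 2 / (cn d + 1) * cn (w - z).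
  split; apply: le_trans E _; last by rewrite ler_wpM2r ?cn_ge0 // ge_min lexx orbT.
  by rewrite -[leRHS]mul1r ler_wpM2r ?cn_ge0 // ge_min lexx.
move=> {E} E1 E2.
have E3 : cn (f w - f z) <= (cn c + 1) * cn (w - z).
  have -> : f w - f z = f w - f z - c * (w - z) + c * (w - z) by ring.
  by apply: le_trans (cnD _ _) _; rewrite cnM; lra.
have E4 : cn (f w - f z) < q by apply: le_lt_trans E3 _; rewrite mulrC.
have -> : g (f w) - g (f z) - d * c * (w - z) =
  (g (f w) - g (f z) - d * (f w - f z)) + d * (f w - f z - c * (w - z)) by ring.
apply: le_trans (cnD _ _) _; rewrite cnM.
have H1 : cn (g (f w) - g (f z) - d * (f w - f z)) <= e / 2 * cn (w - z).
  apply: le_trans (h2 _ E4) _; rewrite -[leLHS]mulrA.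
  apply: ler_wpM2l; first by rewrite divr_ge0 // ltW.
  by rewrite ler_pdivrMl.
have H2 : cn d * cn (f w - f z - c * (w - z)) <= e / 2 * cn (w - z).
  apply: (@le_trans _ _ ((cn d + 1) * cn (f w - f z - c * (w - z)))).
    by rewrite ler_wpM2r ?cn_ge0 // lerDl.
  by rewrite -ler_pdivlMl // (mulrC (_ + 1)^-1) mulrAC.
lra.
Qed.

Definition cexp (w : C) : C := (expR (re w))%:C * pt (cos (im w)) (sin (im w)).

Lemma cexpD w h : cexp (w + h) = cexp w * cexp h.
Proof.
rewrite /cexp reD imD expRD cosD sinD rmorphM /=.
case: w => a b; case: h => a' b' /=.
by apply/eqP; rewrite eq_complex /=; apply/andP; split; apply/eqP; ring.
Qed.

(** Only the derivatives of exp, sin and cos at 0 enter; the functional equation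
    moves differentiability to every other point. *)
Lemma cexp_cdif0 : cdif cexp 0 1.
Proof.
move=> e e0.
have [e8 [e80 e81]] : exists q : R, 0 < q /\ (q <= e / 8 /\ q <= 1 / 2).
  exists (Num.min (e / 8) (1 / 2)).
  by rewrite lt_min !divr_gt0 // !ge_min !lexx orbT.
have [d1 d10 h1] := is_derive_eps (is_derive_expR 0) e80.
have [d2 d20 h2] := is_derive_eps (is_derive_sin 0) e80.
have [d3 d30 h3] := is_derive_eps (is_derive_cos 0) e80.
exists (Num.min (Num.min d1 d2) (Num.min d3 e8)) => [|w].
  by rewrite !lt_min d10 d20 d30 e80.
rewrite subr0 !lt_min => /andP[/andP[b1 b2] /andP[b3 b4]].
have rw := re_le_cn w; have iw := im_le_cn w.
move: (h1 _ (le_lt_trans rw b1)) (h2 _ (le_lt_trans iw b2)) (h3 _ (le_lt_trans iw b3)).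
rewrite !add0r expR0 sin0 cos0 subr0 oppr0 !mul0r subr0 !mul1r => E1 E2 E3.
have -> : cexp 0 = 1 by rewrite /cexp /= expR0 cos0 sin0 /pt mulr0 addr0 mulr1.
apply: le_trans (cn_le_reim _) _.
rewrite !reB !imB /cexp reZ re_pt.
have -> : im ((expR (re w))%:C * pt (cos (im w)) (sin (im w))) =
    expR (re w) * sin (im w).
  rewrite -[in RHS](im_pt (cos (im w)) (sin (im w))).
  by case: (pt _ _) => ? ? /=; rewrite mul0r addr0.
rewrite (_ : re 1 = 1) // (_ : im 1 = 0) // subr0.
move: (cn_ge0 w) rw iw b4 E1 E2 E3.
move: (expR (re w)) (cos (im w)) (sin (im w)) (cn w : R) => A c s n.
move: (re w) (im w) => a b n0 an bn ne E1 E2 E3.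
move: e8 e80 e81 ne E1 E2 E3 {h1 h2 h3} => q q0 [q1 q2] nq E1 E2 E3.
have A2 : A <= 2.
  suff : A - 1 - a <= q * `|a| by have := ler_norm a; nra.
  exact: le_trans (ler_norm _) E1.
have E1' : `|A - 1 - a| <= q * n by apply: le_trans E1 _; rewrite ler_pM2l.
have E2' : `|s - b| <= q * n by apply: le_trans E2 _; rewrite ler_pM2l.
have E3' : `|c - 1| <= q * n by apply: le_trans E3 _; rewrite ler_pM2l.
have A0 : 0 <= A.
  suff : - (A - 1 - a) <= q * `|a| by have := ler_norm (- a); rewrite normrN; nra.
  by apply: le_trans (ler_norm _) _; rewrite normrN.
have F1 : `|A * (c - 1)| <= 2 * (q * n) by rewrite normrM ger0_norm // ler_pM.
have F2 : `|A * (s - b)| <= 2 * (q * n) by rewrite normrM ger0_norm // ler_pM.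
have F3 : `|(A - 1 - a) * b| <= q * n.
  by rewrite normrM -[leRHS]mulr1 ler_pM //; lra.
have F4 : `|a * b| <= q * n by rewrite normrM ler_pM //; lra.
have -> : A * c - 1 - a = A * (c - 1) + (A - 1 - a) by ring.
have -> : A * s - b = A * (s - b) + (A - 1 - a) * b + a * b by ring.
apply: le_trans (lerD (ler_normD _ _) (ler_normD _ _)) _.
have := ler_normD (A * (s - b)) ((A - 1 - a) * b).
have : 8 * (q * n) <= e * n by rewrite mulrA ler_wpM2r //; lra.
have : 0 <= q * n by rewrite mulr_ge0 // ltW.
lra.
Qed.

Lemma cexp_cdif w : cdif cexp w (cexp w).
Proof.
move=> e e0.
have c0 : 0 < cn (cexp w) + 1 by rewrite ltr_wpDl ?cn_ge0.
have [d d0 hd] := cexp_cdif0 (divr_gt0 e0 c0).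
exists d => // h /[dup] hh; rewrite -{1}[h - w]subr0 => /hd.
have -> : cexp 0 = 1 by rewrite /cexp /= expR0 cos0 sin0 /pt mulr0 addr0 mulr1.
rewrite subr0 mul1r => H.
have -> : cexp h = cexp w * cexp (h - w) by rewrite -cexpD addrC subrK.
have -> : cexp w * cexp (h - w) - cexp w - cexp w * (h - w) =
  cexp w * (cexp (h - w) - 1 - (h - w)) by ring.
rewrite cnM; apply: le_trans (ler_wpM2l (cn_ge0 _) H) _.
have -> : e * cn (h - w) = (cn (cexp w) + 1) * (e / (cn (cexp w) + 1) * cn (h - w)).
  by field; rewrite gt_eqF.
by rewrite ler_wpM2r ?lerDl // mulr_ge0 ?cn_ge0 // divr_ge0 // ltW.
Qed.

Lemma cn_cis t : cn (pt (cos t) (sin t) : C) = 1.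
Proof.
apply/eqP; rewrite -(@eqrXn2 _ 2) ?cn_ge0 //; apply/eqP.
by rewrite sqr_cn re_pt im_pt cos2Dsin2 expr1n.
Qed.

Lemma cn_cexp w : cn (cexp w) = expR (re w).
Proof. by rewrite /cexp cnM cn_cis mulr1 cn_real ger0_norm ?expR_ge0. Qed.

End Cdif.

(** * Means on circles and the strong maximum principle *)

Section MeanValue.
Variable R : realType.
Local Notation C := R[i].

Definition circle_pt (p : C) (r t : R) : C := p + r%:C * pt (cos t) (sin t).

Lemma circle_pt_cexp p x t : p + cexp (pt x t) = circle_pt p (expR x) t.
Proof. by rewrite /cexp re_pt im_pt. Qed.

Lemma cn_circle_pt p r t : 0 <= r -> cn (circle_pt p r t - p) = r.
Proof.
by move=> r0; rewrite /circle_pt addrAC subrr add0r cnM cn_cis mulr1 cn_real ger0_norm.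
Qed.

Lemma circle_pt_polar p z : exists2 t, 0 <= t <= pi *+ 2 & z = circle_pt p (cn (z - p)) t.
Proof.
have [->|zp] := eqVneq z p.
  exists 0; first by rewrite lexx mulrn_wge0 // pi_ge0.
  by rewrite /circle_pt subrr cn0 mul0r addr0.
set r := cn (z - p); have r0 : 0 < r by rewrite /r cn_gt0 subr_eq0.
pose a := re (z - p) / r; pose b := im (z - p) / r.
have ab : a ^+ 2 + b ^+ 2 = 1.
  by rewrite /a /b !expr_div_n -mulrDl -sqr_cn divff // expf_neq0 // gt_eqF.
have a1 : -1 <= a <= 1 by apply/andP; split; nra.
have ezp t : cos t = a -> sin t = b -> z = circle_pt p r t.
  move=> ca sb; rewrite /circle_pt ca sb.
  have -> : r%:C * pt a b = z - p.
    rewrite [RHS]pt_reim /pt /a /b !rmorphM !fmorphV /=; field.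
    by rewrite -(rmorph0 (real_complex R)) (inj_eq (@complexI R)) gt_eqF.
  by rewrite addrC subrK.
have pi0 := pi_ge0 R.
have [b0|b0] := leP 0 b.
  exists (acos a); first by rewrite acos_ge0 //= (le_trans (acos_lepi a1)) // mulr2n lerDl.
  by apply: ezp; rewrite ?acosK ?sin_acos // -[RHS]ger0_norm // -sqrtr_sqr; congr Num.sqrt; lra.
exists (pi *+ 2 - acos a).
  by rewrite subr_ge0 (le_trans (acos_lepi a1)) ?mulr2n ?lerDl //= lerBlDr lerDl acos_ge0.
apply: ezp; rewrite addrC.
  by rewrite cosD2pi cosN acosK.
rewrite sinD2pi sinN sin_acos // -[b]opprK; congr (- _).
rewrite -[RHS]ger0_norm -?sqrtr_sqr; last by rewrite oppr_ge0 ltW.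
by congr Num.sqrt; rewrite sqrrN; lra.
Qed.

(** The point p may be exceptional: this is what lets the maximum principle
    apply to difference quotients before they are known to be holomorphic. *)
Definition punctured_holo (f : C -> C) p (rho : R) := cont_at f p /\
  forall z, 0 < cn (z - p) <= rho -> exists c, cdif f z c.

(** The logarithmic rectangle below the circle of radius rho has horizontal sides
    that are identified by e^(2 pi i) = 1, so Goursat's lemma compares the means on
    two vertical sides, that is, on two concentric circles. The small circle is
    chosen where f is close to f p. *)
Lemma circle_mean f p rho : 0 < rho -> punctured_holo f p rho ->
  forall e : R, 0 < e -> exists N, forall n, (N <= n)%N ->
  cn (trapezoid n (fun t => f (circle_pt p rho t)) 0 (pi *+ 2) - (pi *+ 2)%:C * f p) <= e.
Proof.
move=> rho0 [fc fd] e e0.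
have pi0 := pi_gt0 R.
have pp : 0 < pi *+ 2 :> R by rewrite mulrn_wgt0.
have [d d0 hd] := fc _ (divr_gt0 (divr_gt0 e0 (ltr0n R 2 : (0:R) < 2)) pp).
pose r0 := Num.min (rho / 2) (d / 2).
have r00 : 0 < r0 by rewrite lt_min !divr_gt0.
have r0rho : r0 <= rho / 2 by rewrite ge_min lexx.
have r0d : r0 <= d / 2 by rewrite ge_min lexx orbT.
pose x0 := ln r0; pose s := ln rho - x0.
have s0 : 0 < s by rewrite subr_gt0 ltr_ln //; lra.
pose F w := f (p + cexp w).
have q0 : 0 < e / 2 / (s + pi *+ 2) ^+ 2.
  by rewrite divr_gt0 ?divr_gt0 // exprn_gt0 // addr_gt0.
have [|N hN] := goursat (F := F) (x := x0) (y := 0) s0 pp q0.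
  move=> z hz1 _; have [|c hc] := fd (p + cexp z).
    rewrite addrAC subrr add0r cn_cexp expR_gt0 /=.
    by rewrite -(lnK (_ : rho \in Num.pos)) // ler_expR; rewrite /s in hz1; lra.
  exists (c * cexp z); apply: (@cdif_comp _ (fun w => p + cexp w) f) => //.
  move=> e' e'0; have [d' d'0 hd'] := cexp_cdif z e'0.
  exists d' => // w /hd'.
  by have -> : p + cexp w - (p + cexp z) = cexp w - cexp z by ring.
exists N => n /hN /=; rewrite divfK; last by rewrite expf_neq0 // gt_eqF // addr_gt0.
rewrite /boundary_sum add0r.
have -> : trapezoid n (fun u => F (pt u (pi *+ 2))) x0 s = trapezoid n (fun u => F (pt u 0)) x0 s.
  congr (trapezoid n _ x0 s); apply/funext => u.
  by rewrite /F !circle_pt_cexp /circle_pt cos2pi sin2pi cos0 sin0.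
set E1 := trapezoid n _ 0 _; set E2 := trapezoid n (fun v => _ (pt x0 v)) 0 _.
set E3 := trapezoid n _ x0 s.
have -> : E3 + 'i%C * E1 - E3 - 'i%C * E2 = 'i%C * (E1 - E2) by ring.
rewrite cnM cn_i mul1r => H.
have -> : trapezoid n (fun t => f (circle_pt p rho t)) 0 (pi *+ 2) = E1.
  congr (trapezoid n _ 0 _); apply/funext => t.
  by rewrite /F circle_pt_cexp /s addrC subrK lnK.
apply: le_trans (cn_trans _ E2 _) _.
suff : cn (E2 - (pi *+ 2)%:C * f p) <= e / 2 by lra.
rewrite -(trapezoid_const n (f p) 0).
have -> : E2 - trapezoid n (fun=> f p) 0 (pi *+ 2) =
  trapezoid n (fun v => (-1) * f p + F (pt x0 v)) 0 (pi *+ 2).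
  by rewrite (trapezoid_lin n (-1) (fun=> f p)) mulN1r addrC.
have -> : e / 2 = (pi *+ 2) * (e / 2 / (pi *+ 2)) by rewrite [RHS]mulrC divfK // gt_eqF.
apply: trapezoid_bound => [|v _]; first exact: ltW.
rewrite mulN1r addrC /F circle_pt_cexp lnK //.
by apply: hd; rewrite cn_circle_pt ?ltW //; lra.
Qed.

(** After division by f p the values on the circle lie in the unit disc and their
    means tend to 1, so no value can differ from 1. *)
Lemma strong_max f p rho : 0 < rho -> punctured_holo f p rho ->
  (forall z, cn (z - p) = rho -> cn (f z) <= cn (f p)) ->
  forall z, cn (z - p) = rho -> f z = f p.
Proof.
move=> rho0 fpd fmax z zrho.
have [t t2 zt] := circle_pt_polar p z; rewrite zrho in zt.
have [fp0|fp0] := eqVneq (f p) 0.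
  apply/eqP; rewrite fp0 -cn_eq0 eq_le cn_ge0 andbT.
  by have := fmax z zrho; rewrite fp0 cn0.
pose phi v := (f p)^-1 * f (circle_pt p rho v).
have phi1 v : cn (phi v) <= 1.
  rewrite cnM cnV ler_pdivrMl ?cn_gt0 // mulr1.
  by apply: fmax; rewrite cn_circle_pt // ltW.
have rphi v : re (phi v) <= 1.
  by apply: le_trans (phi1 v); apply: le_trans (re_le_cn _); exact: ler_norm.
suff : 1 <= re (phi t).
  move=> /(cn_re_eq (phi1 t)) h; rewrite zt.
  by apply: (mulfI (invr_neq0 fp0)); rewrite mulVf.
rewrite leNgt; apply/negP => lt1.
have pp : 0 < pi *+ 2 :> R by rewrite mulrn_wgt0 // pi_gt0.
pose eta := (1 - re (phi t)) / 2.
have eta0 : 0 < eta by rewrite /eta; lra.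
have [|c1 /cdif_cont fcz] := fpd.2 z; first by rewrite zrho rho0 lexx.
have fn0 : 0 < cn (f p) by rewrite cn_gt0.
have [d d0 hd] := fcz _ (mulr_gt0 eta0 fn0).
have [d' d'0 hd'] := cdif_cont (cexp_cdif (pt (ln rho) t)) (divr_gt0 d0 (ltr0n R 2 : (0:R) < 2)).
have [m hm] := halving_lt (ltW pp) d'0.
have close v : `|v - t| <= pi *+ 2 / 2 ^+ m -> re (phi v) <= 1 - eta.
  move=> hv; suff : cn (phi v - phi t) <= eta.
    move=> /(le_trans (re_le_cn _)) /(le_trans (ler_norm _)); rewrite reB /eta; lra.
  rewrite /phi -mulrBr cnM cnV ler_pdivrMl // mulrC -zt.
  apply: hd; apply: (@le_lt_trans _ _ (d / 2)); last by lra.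
  have -> : circle_pt p rho v - z = cexp (pt (ln rho) v) - cexp (pt (ln rho) t).
    have E u : circle_pt p rho u = p + cexp (pt (ln rho) u) by rewrite circle_pt_cexp lnK.
    by rewrite zt !E; ring.
  apply: hd'; apply: le_lt_trans hm.
  apply: le_trans hv; apply: le_trans (cn_le_reim _) _.
  by rewrite reB imB !re_pt !im_pt subrr normr0 add0r.
have g0 : 0 < eta * (pi *+ 2) / 2 ^+ m by rewrite divr_gt0 ?exprn_gt0 // mulr_gt0.
have e0 : 0 < eta * (pi *+ 2) / 2 ^+ m / 2 * cn (f p) by rewrite mulr_gt0 // divr_gt0.
have [N hN] := circle_mean rho0 fpd e0.
have := hN (maxn N m) (leq_maxl _ _).
rewrite -ler_pdivrMr // mulrC -cnV -cnM mulrBr -trapezoid_scale -/phi.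
have -> : (f p)^-1 * ((pi *+ 2)%:C * f p) = (pi *+ 2)%:C by rewrite mulrC mulfK.
move=> H.
have : re (trapezoid (maxn N m) phi 0 (pi *+ 2)) <= pi *+ 2 - eta * (pi *+ 2) / 2 ^+ m.
  have t2' : 0 <= t <= 0 + pi *+ 2 by rewrite add0r.
  apply: (trapezoid_re_lt (ltW pp) t2'); last exact: leq_maxr.
    by move=> v _; exact: rphi.
  by move=> v _; exact: close.
move: H => /(le_trans (re_le_cn _)); rewrite reB ler_norml => /andP[+ _].
rewrite (_ : re (pi *+ 2)%:C = pi *+ 2) //.
move: g0; set q := eta * _ / _; lra.
Qed.

End MeanValue.

(** * Compactness of closed discs *)

Section Disc.
Variable R : realType.
Local Notation C := R[i].
Implicit Types (f g : C -> C) (p z w : C) (r : R).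

(** The neighbourhoods of R[i] come from balls with radii in R[i]; real radii
    suffice. *)
Lemma nbhs_cn (z : Cplx R) (P : set (Cplx R)) :
  nbhs z P <-> exists2 d : R, 0 < d & forall w, cn (w - z) < d -> P w.
Proof.
split=> [/nbhs_normP[d /= d0 h]|[d d0 h]].
  have rd : d = (re d)%:C by move: d0; rewrite ltcE => /andP[/eqP]; case: (d) => ? ? /= ->.
  exists (re d) => [|w hw]; first by rewrite -ltcR -rd.
  by apply: h; rewrite /= norm_cn rd ltcR cnBC.
apply: (proj2 (@nbhs_normP R[i] (Cplx R) z P)).
exists d%:C => [|w /=]; first by rewrite /= ltcR.
by rewrite norm_cn ltcR cnBC => /h.
Qed.

Lemma cont_atP (f : Cplx R -> Cplx R) z :
  cont_at f z <-> {for z, continuous f}.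
Proof.
split=> [h A /nbhs_cn[d d0 hd]|h e e0].
  have [d' d'0 hd'] := h _ (divr_gt0 d0 (ltr0n R 2 : (0:R) < 2)).
  apply/nbhs_cn; exists d' => // w /hd' hw; apply: hd.
  by apply: le_lt_trans hw _; lra.
have /h/nbhs_cn[d d0 hd] : nbhs (f z : Cplx R) [set w | cn (w - f z) <= e].
  by apply/nbhs_cn; exists e => // w /ltW.
by exists d.
Qed.

Lemma lip_continuous (h : Cplx R -> R) :
  (forall z w, `|h z - h w| <= cn (z - w)) -> continuous h.
Proof.
move=> hl z A /nbhs_normP[e /= e0 he].
apply/nbhs_cn; exists e => // w hw; apply: he => /=.
by apply: le_lt_trans (hl _ _) _; rewrite cnBC.
Qed.

Lemma re_continuous : continuous (fun z : Cplx R => re z).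
Proof. by apply: lip_continuous => z w; rewrite -reB; exact: re_le_cn. Qed.

Lemma cn_continuous : continuous (fun z : Cplx R => cn z : R).
Proof.
apply: lip_continuous => z w; rewrite ler_norml lerNl opprB.
by rewrite cn_lerB -cnBC cn_lerB.
Qed.

Lemma pt_continuous : continuous (fun u : R * R => pt u.1 u.2 : Cplx R).
Proof.
move=> [a b] A /nbhs_cn[d d0 hd].
apply: (proj2 (@nbhs_normP R (R * R)%type (a, b) _)).
exists (d / 2) => [/=|[x y] /=]; first by rewrite divr_gt0.
rewrite gt_max => /andP[h1 h2]; apply: hd.
apply: le_lt_trans (cn_le_reim _) _; rewrite reB imB !re_pt !im_pt.
by rewrite distrC (distrC y); lra.
Qed.

Lemma disc_closed p r : closed [set z : Cplx R | cn (z - p) <= r].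
Proof.
apply: (@preimage_closed _ _ (fun z : Cplx R => cn (z - p) : R) [set x | x <= r]).
  move=> z _; apply: lip_continuous => {}z w.
  have e : z - w = z - p - (w - p) by ring.
  by rewrite ler_norml lerNl opprB e cn_lerB cnBC cn_lerB.
exact: closed_le.
Qed.

Lemma disc_compact p r : compact [set z : Cplx R | cn (z - p) <= r].
Proof.
pose I : set R := `[re p - r, re p + r]%classic.
pose J : set R := `[im p - r, im p + r]%classic.
apply: (subclosed_compact _ (B := (fun u : R * R => pt u.1 u.2 : Cplx R) @` (I `*` J))).
  exact: disc_closed.
  apply: continuous_compact; last by apply: compact_setX; exact: segment_compact.
  exact/continuous_subspaceT/pt_continuous.
move=> z /= hz; exists (re z, im z) => /=; last by rewrite -pt_reim.
have := re_le_cn (z - p); have := im_le_cn (z - p).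
rewrite reB imB !ler_norml => h1 h2; split; rewrite /I /J /= in_itv /=; lra.
Qed.

(** The largest real part singles out a maximal point that cannot lie inside the
    disc when g is holomorphic: by [strong_max] the points on a small circle about
    it would be maximal as well. *)
Lemma disc_max_re g p r : 0 <= r -> (forall z, cn (z - p) <= r -> cont_at g z) ->
  exists z0, [/\ cn (z0 - p) <= r,
    forall z, cn (z - p) <= r -> cn (g z) <= cn (g z0) &
    forall z, cn (z - p) <= r -> cn (g z) = cn (g z0) -> re z <= re z0].
Proof.
move=> r0 gc; pose D := [set z : Cplx R | cn (z - p) <= r].
pose G (z : Cplx R) : R := cn (g z).
have Gc : {in D, continuous G}.
  move=> z; rewrite inE => /gc/cont_atP h.
  apply: (@continuous_comp _ _ _ (g : Cplx R -> Cplx R) (fun z : Cplx R => cn z : R) z h).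
  exact: cn_continuous.
have D0 : D !=set0 by exists p; rewrite /D /= subrr cn0.
have [c cD cmax] := compact_EVT_max D0 (@disc_compact p r) (continuous_in_subspaceT Gc).
pose E := D `&` [set z | G c <= G z].
have Ecl : closed E.
  move=> z zE; have zD : D z.
    by apply: disc_closed => B /zE[w [[wD _] Bw]]; exists w.
  split=> //; rewrite /= leNgt; apply/negP => lt.
  have e0 : 0 < (G c - G z) / 2 by lra.
  have [d d0 hd] := gc z zD _ e0.
  have [|w [[_ wG] hw]] := zE [set w | cn (w - z) < d].
    by apply/nbhs_cn; exists d.
  have := hd w hw; have := cn_lerB (g w) (g z); move: wG lt; rewrite /= /G; lra.
have Ecpt : compact E by apply: (subclosed_compact Ecl (@disc_compact p r)) => z [].
have E0 : E !=set0 by exists c; split; [rewrite inE in cD | rewrite /= lexx].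
have [z0 z0E z0max] := compact_EVT_max E0 Ecpt (continuous_subspaceT re_continuous).
move: z0E; rewrite inE => -[z0D cz0]; exists z0; split => // z zD.
  by apply: le_trans cz0; apply: cmax; rewrite inE.
by move=> e; apply: z0max; rewrite inE; split => //; rewrite /= /G e.
Qed.

End Disc.

(** * The maximum principle for difference quotients *)

Section MaximumPrinciple.
Variable R : realType.
Local Notation C := R[i].
Implicit Types (f g : C -> C) (p z w : C) (r : R).

(** Differentiability near z, with z itself only a point of continuity. *)
Definition near_holo g z := exists2 rho : R, 0 < rho & punctured_holo g z rho.

Lemma near_holo_cont g z : near_holo g z -> cont_at g z. Proof. by case=> ? _ []. Qed.

Lemma near_holo_shrink g z (q : R) : 0 < q -> near_holo g z ->
  exists2 rho : R, 0 < rho <= q & punctured_holo g z rho.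
Proof.
move=> q0 [rho rho0 [gc gd]]; exists (Num.min rho q).
  by rewrite lt_min rho0 q0 ge_min lexx orbT.
split=> // w; rewrite le_min => /and3P[w0 h _].
by apply: gd; rewrite w0.
Qed.

Lemma cdif_near_holo g z (q : R) : 0 < q ->
  (forall w, cn (w - z) < q -> exists c, cdif g w c) -> near_holo g z.
Proof.
move=> q0 h; exists (q / 2); first by rewrite divr_gt0.
split; first by have [|c /cdif_cont] := h z; rewrite ?subrr ?cn0.
by move=> w /andP[_ hw]; apply: h; lra.
Qed.

Lemma weak_max g p r (M : R) : 0 <= r -> (forall z, cn (z - p) <= r -> near_holo g z) ->
  (forall z, cn (z - p) = r -> cn (g z) <= M) ->
  forall z, cn (z - p) <= r -> cn (g z) <= M.
Proof.
move=> r0 gi gM z hz.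
have [z0 [z0r zmax zre]] := disc_max_re r0 (fun z hz => near_holo_cont (gi z hz)).
apply: le_trans (zmax z hz) _.
have [/gM//|z0lt] := eqVneq (cn (z0 - p)) r.
have lt : 0 < r - cn (z0 - p) by rewrite subr_gt0 lt_neqAle z0lt.
have [rho /andP[rho0 rhole] gp] := near_holo_shrink lt (gi z0 z0r).
have inD w : cn (w - z0) = rho -> cn (w - p) <= r.
  by move=> e; apply: le_trans (cn_trans _ z0 _) _; lra.
have e1 : cn (z0 + rho%:C - z0) = rho.
  by rewrite addrAC subrr add0r cn_real gtr0_norm.
have := strong_max rho0 gp (fun w hw => zmax w (inD w hw)) e1.
move=> e2; have := zre _ (inD _ e1); rewrite e2 => /(_ erefl).
by rewrite reD /=; lra.
Qed.

Lemma near_cdif f g z c (q : R) : 0 < q ->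
  (forall w, cn (w - z) < q -> f w = g w) -> cdif f z c -> cdif g z c.
Proof.
move=> q0 fg df e e0; have [d d0 hd] := df e e0.
exists (Num.min d q) => [|w]; first by rewrite lt_min d0.
rewrite lt_min => /andP[/hd + h2].
by rewrite !fg // subrr cn0.
Qed.

Lemma near_cont f g z (q : R) : 0 < q ->
  (forall w, cn (w - z) < q -> f w = g w) -> cont_at f z -> cont_at g z.
Proof.
move=> q0 fg df e e0; have [d d0 hd] := df e e0.
exists (Num.min d q) => [|w]; first by rewrite lt_min d0.
rewrite lt_min => /andP[/hd + h2].
by rewrite !fg // subrr cn0.
Qed.

Lemma cdif_cst (k : C) z : cdif (fun=> k) z 0.
Proof.
move=> e e0; exists 1 => // w _.
by rewrite subrr mul0r subrr cn0 mulr_ge0 ?cn_ge0 // ltW.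
Qed.

Lemma cdif_id z : cdif id z 1.
Proof.
move=> e e0; exists 1 => // w _.
by rewrite mul1r subrr cn0 mulr_ge0 ?cn_ge0 // ltW.
Qed.

Lemma cdifD f g z c d : cdif f z c -> cdif g z d -> cdif (fun w => f w + g w) z (c + d).
Proof.
move=> hf hg e e0.
have e2 : 0 < e / 2 by rewrite divr_gt0.
have [q q0 hq] := hf _ e2; have [r r0 hr] := hg _ e2.
exists (Num.min q r) => [|w]; first by rewrite lt_min q0.
rewrite lt_min => /andP[/hq h1 /hr h2].
have -> : f w + g w - (f z + g z) - (c + d) * (w - z) =
  (f w - f z - c * (w - z)) + (g w - g z - d * (w - z)) by ring.
by apply: le_trans (cnD _ _) _; lra.
Qed.

Lemma cont_bound g z : cont_at g z ->
  exists2 r : R, 0 < r & forall w, cn (w - z) < r -> cn (g w) <= cn (g z) + 1.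
Proof.
move=> gc; have [r r0 hr] := gc 1 ltr01; exists r => // w /hr h.
have -> : g w = g z + (g w - g z) by ring.
by apply: le_trans (cnD _ _) _; rewrite lerD2l.
Qed.

Lemma cdifM f g z c d : cdif f z c -> cdif g z d ->
  cdif (fun w => f w * g w) z (c * g z + f z * d).
Proof.
move=> hf hg e e0.
have e3 : 0 < e / 3 by rewrite divr_gt0.
have G0 : 0 < cn (g z) + 1 by rewrite ltr_wpDl ?cn_ge0.
have F0 : 0 < cn (f z) + 1 by rewrite ltr_wpDl ?cn_ge0.
have c0 : 0 < cn c + 1 by rewrite ltr_wpDl ?cn_ge0.
have [r1 r10 h1] := hf _ (divr_gt0 e3 G0).
have [r2 r20 h2] := hg _ (divr_gt0 e3 F0).
have [r3 r30 h3] := cdif_cont hg (divr_gt0 e3 c0).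
have [r4 r40 h4] := cont_bound (cdif_cont hg).
exists (Num.min (Num.min r1 r2) (Num.min r3 r4)) => [|w].
  by rewrite !lt_min r10 r20 r30.
rewrite !lt_min => /andP[/andP[/h1 E1 /h2 E2] /andP[/h3 E3 /h4 E4]].
have -> : f w * g w - f z * g z - (c * g z + f z * d) * (w - z) =
  (f w - f z - c * (w - z)) * g w + c * (g w - g z) * (w - z) +
  f z * (g w - g z - d * (w - z)) by ring.
apply: le_trans (cnD _ _) _; apply: le_trans (lerD (cnD _ _) (lexx _)) _.
rewrite !cnM; set n := cn (w - z) in E1 E2 *.
have n0 : 0 <= n by exact: cn_ge0.
have mul3 (x y u v t : R) : 0 < v -> 0 <= y -> x <= u / v * t -> y <= v -> 0 <= x ->
  x * y <= u * t.
  move=> v0 y0 hx hy x0; apply: le_trans (ler_pM x0 y0 hx hy) _.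
  by have -> : u / v * t * v = u * t by field; rewrite gt_eqF.
have B1 : cn (f w - f z - c * (w - z)) * cn (g w) <= e / 3 * n.
  by apply: mul3 E1 E4 _ => //; exact: cn_ge0.
have B2 : cn (g w - g z) * cn c <= e / 3 * 1.
  apply: (mul3 _ _ _ (cn c + 1)) => //; rewrite ?cn_ge0 ?mulr1 //; lra.
have B3 : cn (g w - g z - d * (w - z)) * cn (f z) <= e / 3 * n.
  apply: mul3 E2 _ _ => //; rewrite ?cn_ge0 //; lra.
have B2' : cn (g w - g z) * cn c * n <= e / 3 * n by rewrite ler_wpM2r //; lra.
rewrite (mulrC (cn c)) (mulrC (cn (f z))); lra.
Qed.

Lemma contM f g z : cont_at f z -> cont_at g z -> cont_at (fun w => f w * g w) z.
Proof.
move=> hf hg e e0.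
have e2 : 0 < e / 2 by rewrite divr_gt0.
have G0 : 0 < cn (g z) + 1 by rewrite ltr_wpDl ?cn_ge0.
have F0 : 0 < cn (f z) + 1 by rewrite ltr_wpDl ?cn_ge0.
have [r1 r10 h1] := hf _ (divr_gt0 e2 G0).
have [r2 r20 h2] := hg _ (divr_gt0 e2 F0).
have [r4 r40 h4] := cont_bound hg.
exists (Num.min (Num.min r1 r2) r4) => [|w].
  by rewrite !lt_min r10 r20.
rewrite !lt_min => /andP[/andP[/h1 E1 /h2 E2] /h4 E4].
have -> : f w * g w - f z * g z = (f w - f z) * g w + f z * (g w - g z) by ring.
apply: le_trans (cnD _ _) _; rewrite !cnM.
have B1 : cn (f w - f z) * cn (g w) <= e / 2.
  apply: le_trans (ler_pM (cn_ge0 _) (cn_ge0 _) E1 E4) _.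
  by rewrite divfK // gt_eqF.
have B2 : cn (f z) * cn (g w - g z) <= e / 2.
  have F1 : cn (f z) <= cn (f z) + 1 by lra.
  apply: le_trans (ler_pM (cn_ge0 _) (cn_ge0 _) F1 E2) _.
  by rewrite mulrC divfK // gt_eqF.
lra.
Qed.

Lemma cdif_inv z : z != 0 -> cdif (fun w => w^-1) z (- z ^- 2).
Proof.
move=> z0 e e0; have n0 : 0 < cn z by rewrite cn_gt0.
exists (Num.min (cn z / 2) (e * cn z ^+ 3 / 2)) => [|w].
  by rewrite lt_min divr_gt0 //= divr_gt0 // mulr_gt0 // exprn_gt0.
rewrite lt_min => /andP[h1 h2].
have h3 : cn z / 2 <= cn w by have := cn_lerB z (z - w); rewrite subKr cnBC; lra.
have w0 : w != 0 by rewrite -cn_gt0; lra.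
have -> : w^-1 - z^-1 - - z ^- 2 * (w - z) = (w - z) * (w - z) / (z ^+ 2 * w).
  by field; rewrite z0 w0.
rewrite !cnM cnV cnM cnX ler_pdivrMr; last by rewrite mulr_gt0 ?exprn_gt0 // cn_gt0.
rewrite [leRHS]mulrAC ler_wpM2r ?cn_ge0 //; apply: le_trans (ltW h2) _.
have -> : e * cn z ^+ 3 / 2 = e * (cn z ^+ 2 * (cn z / 2)) by rewrite exprS; ring.
by rewrite ler_pM2l ?ler_wpM2l ?exprn_ge0 ?cn_ge0 //; lra.
Qed.

Lemma cdifV f z c : f z != 0 -> cdif f z c ->
  cdif (fun w => (f w)^-1) z (- (f z) ^- 2 * c).
Proof. by move=> f0 hf; apply: (cdif_comp hf); exact: cdif_inv. Qed.

Lemma cdifB_cst f z c k : cdif f z c -> cdif (fun w => f w - k) z c.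
Proof. by move=> hf; rewrite -[c]addr0; apply: cdifD => //; exact: cdif_cst. Qed.

Lemma cdifX f z c n : cdif f z c -> exists d, cdif (fun w => f w ^+ n) z d.
Proof.
move=> hf; elim: n => [|n [d IH]].
  by exists 0; exact: cdif_cst.
exists (c * f z ^+ n + f z * d).
have -> : (fun w => f w ^+ n.+1) = (fun w => f w * f w ^+ n).
  by apply/funext => w; rewrite exprS.
exact: cdifM.
Qed.

(** The difference quotient of g at d, completed by the value c at d; c is meant
    to be the derivative of g at d. *)
Definition diff_quotient g d c z := if z == d then c else (g z - g d) / (z - d).

Lemma diff_quotient_eq g d c : diff_quotient g d c d = c.
Proof. by rewrite /diff_quotient eqxx. Qed.

Lemma diff_quotientE g d c z : z != d -> diff_quotient g d c z = (g z - g d) / (z - d).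
Proof. by rewrite /diff_quotient => /negbTE ->. Qed.

Lemma diff_quotient_near g d c w : w != d ->
  forall v, cn (v - w) < cn (w - d) -> (g v - g d) / (v - d) = diff_quotient g d c v.
Proof.
move=> wd v hv; rewrite diff_quotientE //.
by apply: contraTneq hv => ->; rewrite cnBC ltxx.
Qed.

Lemma cdif_diff_quotient g d c w k :
  w != d -> cdif g w k -> exists c', cdif (diff_quotient g d c) w c'.
Proof.
move=> wd gk.
have wd0 : 0 < cn (w - d) by rewrite cn_gt0 subr_eq0.
have wd1 : w - d != 0 by rewrite subr_eq0.
eexists; apply: near_cdif wd0 (diff_quotient_near g c wd) _.
apply: cdifM (cdifB_cst _ gk) _.
exact: (@cdifV (fun v => v - d)) wd1 (cdifB_cst _ (cdif_id w)).
Qed.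

Lemma cont_diff_quotient g d c w : w != d -> cont_at g w -> cont_at (diff_quotient g d c) w.
Proof.
move=> wd gc.
have wd0 : 0 < cn (w - d) by rewrite cn_gt0 subr_eq0.
have wd1 : w - d != 0 by rewrite subr_eq0.
apply: near_cont wd0 (diff_quotient_near g c wd) _.
apply: contM; last first.
  exact: cdif_cont (@cdifV (fun v => v - d) _ _ wd1 (cdifB_cst _ (cdif_id w))).
move=> e e0; have [r r0 hr] := gc e e0; exists r => // v /hr.
by have -> : g v - g d - (g w - g d) = g v - g w by ring.
Qed.

Lemma near_holo_quotient g d c z : cdif g d c -> near_holo g z -> near_holo (diff_quotient g d c) z.
Proof.
move=> gd gi; have [zd|zd] := eqVneq z d.
  subst z; case: gi => rho rho0 [gc gp]; exists rho => //; split.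
    move=> e e0; have [q q0 hq] := gd e e0; exists q => // w hw.
    rewrite diff_quotient_eq; have [->|wd] := eqVneq w d.
      by rewrite diff_quotient_eq subrr cn0 ltW.
    rewrite diff_quotientE // -(ler_pM2r (_ : 0 < cn (w - d))); last by rewrite cn_gt0 subr_eq0.
    rewrite -cnM mulrBl divfK ?subr_eq0 //; exact: hq.
  move=> w /[dup] /andP[wd _] /gp[k]; apply: cdif_diff_quotient.
  by rewrite -subr_eq0 -cn_gt0.
have zd0 : 0 < cn (z - d) by rewrite cn_gt0 subr_eq0.
have [rho /andP[rho0 hrho] [gc gp]] := near_holo_shrink (divr_gt0 zd0 (ltr0n R 2 : (0:R) < 2)) gi.
exists rho => //; split; first exact: cont_diff_quotient.
move=> w /[dup] /andP[_ hw] /gp[k]; apply: cdif_diff_quotient.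
by apply: contraTneq hw => ->; rewrite cnBC -ltNge; lra.
Qed.

(** On the boundary circle the denominator is at least r / 2, and the maximum
    principle carries the bound inside. This is the substitute for the Cauchy
    estimates. *)
Lemma diff_quotient_bound g p r (M : R) d c : 0 < r ->
  (forall z, cn (z - p) <= r -> near_holo g z) ->
  (forall z, cn (z - p) <= r -> cn (g z) <= M) ->
  cn (d - p) <= r / 2 -> cdif g d c ->
  forall z, cn (z - p) <= r ->
    near_holo (diff_quotient g d c) z /\ cn (diff_quotient g d c z) <= 4 * M / r.
Proof.
move=> r0 gi gM hd gd z hz; split; first by apply: near_holo_quotient => //; exact: gi.
apply: (@weak_max _ p r) hz; first exact: ltW.
  by move=> w hw; apply: near_holo_quotient => //; exact: gi.
move=> w hw.
have dr : cn (d - p) <= r by lra.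
have wd : r / 2 <= cn (w - d).
  by have := cn_trans w d p; lra.
have wd0 : w != d by rewrite -subr_eq0 -cn_gt0; lra.
rewrite diff_quotientE // cnM cnV ler_pdivrMr; last by lra.
apply: le_trans (cnB _ _) _.
have := gM _ dr; have := gM w; rewrite hw lexx => /(_ isT) h1 h2.
have M0 : 0 <= M by apply: le_trans h2; exact: cn_ge0.
apply: (@le_trans _ _ (4 * M / r * (r / 2))).
  have -> : 4 * M / r * (r / 2) = M + M by field; rewrite gt_eqF.
  exact: lerD.
apply: ler_wpM2l => //; apply: divr_ge0 (ltW r0); exact: mulr_ge0.
Qed.

(** The quotient f / (z - p)^k is holomorphic for every k because f vanishes near
    p; the maximum principle bounds |f z| by a multiple of (|z - p| / q)^k. *)
Lemma identity_disc f p (s r : R) : 0 < s ->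
  (forall z, cn (z - p) < r -> exists c, cdif f z c) ->
  (forall z, cn (z - p) < s -> f z = 0) ->
  forall z, cn (z - p) < r -> f z = 0.
Proof.
move=> s0 fd f0 z hz.
have [zp|zp] := eqVneq z p; first by apply: f0; rewrite zp subrr cn0.
have zp0 : 0 < cn (z - p) by rewrite cn_gt0 subr_eq0.
pose q := (cn (z - p) + r) / 2.
have q0 : 0 < q by rewrite /q; lra.
have qr : q < r by rewrite /q; lra.
have qz : cn (z - p) < q by rewrite /q; lra.
have fi w : cn (w - p) <= q -> near_holo f w.
  move=> hw; apply: (@cdif_near_holo _ _ (r - q)); first by lra.
  by move=> v hv; apply: fd; apply: le_lt_trans (cn_trans _ w _) _; lra.
have [w0 [_ wM _]] := disc_max_re (ltW q0) (fun w hw => near_holo_cont (fi w hw)).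
set M := cn (f w0) in wM.
pose g k w := f w / (w - p) ^+ k.
have gi k w : cn (w - p) <= q -> near_holo (g k) w.
  move=> hw; apply: (@cdif_near_holo _ _ (r - q)); first by lra.
  move=> v hv; have [vp|vp] := eqVneq v p.
    exists 0 => e e0; exists s => // u; rewrite vp => hu.
    rewrite /g f0 // f0 ?subrr ?cn0 // !mul0r !subr0 cn0.
    by rewrite mulr_ge0 ?cn_ge0 // ltW.
  have [|c fc] := fd v.
    by apply: le_lt_trans (cn_trans _ w _) _; lra.
  have [c' hc'] := cdifX k (cdifB_cst p (cdif_id v)).
  eexists; apply: cdifM fc _; apply: cdifV hc'.
  by rewrite expf_neq0 // subr_eq0.
apply/eqP; rewrite -cn_eq0 eq_le cn_ge0 andbT leNgt; apply/negP => fz0.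
pose a := cn (z - p) / q.
have a1 : a < 1 by rewrite ltr_pdivrMr // mul1r.
have a0 : 0 < a by rewrite divr_gt0.
have M0 : 0 <= M by exact: cn_ge0.
have H k : cn (f z) <= M * a ^+ k.
  have := @weak_max (g k) p q (M / q ^+ k) (ltW q0) (gi k) _ z (ltW qz).
  rewrite {2}/g cnM cnV cnX ler_pdivrMr ?exprn_gt0 //.
  have -> : M * a ^+ k = M / q ^+ k * cn (z - p) ^+ k by rewrite /a expr_div_n mulrA mulrAC.
  apply.
  move=> w hw; rewrite /g cnM cnV cnX hw.
  apply: ler_wpM2r; first by rewrite invr_ge0 exprn_ge0 // ltW.
  by apply: wM; rewrite hw.
have := @cvg_geometric R M a; rewrite gtr0_norm // => /(_ a1).
move=> /cvgrPdist_lt /(_ _ fz0)[N _ /(_ N (leqnn N))].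
rewrite /= sub0r normrN ger0_norm; last by rewrite mulr_ge0 // exprn_ge0 // ltW.
by rewrite ltNge H.
Qed.

(** With d z = f z - z one has d (f z) = - d z, so |d (f z) - d z| is twice the
    distance from z to f z. The derivative of d at p is 0, hence d is Lipschitz
    with constant 1 / 4 near p, and d must vanish there. *)
Lemma involution_id f p r : 0 < r ->
  (forall z, cn (z - p) < r -> exists c, cdif f z c) ->
  f p = p -> cdif f p 1 -> (forall z, cn (z - p) < r -> f (f z) = z) ->
  exists2 s : R, 0 < s & forall z, cn (z - p) < s -> f z = z.
Proof.
move=> r0 fd fp fp1 ff.
pose d z := f z - z.
have cdif_d w c : cdif f w c -> cdif d w (c - 1).
  move=> h e e0; have [q q0 hq] := h e e0; exists q => // v /hq.
  by have -> : d v - d w - (c - 1) * (v - w) = f v - f w - c * (v - w) by rewrite /d; ring.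
have dp : d p = 0 by rewrite /d fp subrr.
have [|q q0 hq] := cdif_d p 1 fp1 (1 / 16); first by rewrite divr_gt0.
pose t := Num.min q r / 2.
have t0 : 0 < t by rewrite divr_gt0 // lt_min q0.
have [tq tr] : t < q /\ t < r.
  have : Num.min q r <= q by rewrite ge_min lexx.
  have : Num.min q r <= r by rewrite ge_min lexx orbT.
  by rewrite /t; lra.
have dsmall z : cn (z - p) <= t -> cn (d z) <= 1 / 16 * cn (z - p).
  move=> hz; have := hq z (le_lt_trans hz tq).
  by rewrite dp subr0 subrr mul0r subr0.
have di z : cn (z - p) <= t -> near_holo d z.
  move=> hz; apply: (@cdif_near_holo _ _ (r - t)); first by lra.
  move=> v hv; have [|c hc] := fd v; last by exists (c - 1); exact: cdif_d.
  by apply: le_lt_trans (cn_trans _ z _) _; lra.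
have dM z : cn (z - p) <= t -> cn (d z) <= t / 16.
  by move=> hz; have := dsmall z hz; lra.
exists (t / 4); first by rewrite divr_gt0.
move=> z hz.
have zt : cn (z - p) <= t by have := cn_ge0 (z - p); lra.
have zt2 : cn (z - p) <= t / 2 by have := cn_ge0 (z - p); lra.
have dz := dsmall z zt.
have wt : cn (f z - p) <= t / 2.
  apply: le_trans (cn_trans _ z _) _; rewrite -/(d z).
  have := cn_ge0 (z - p); lra.
have wt' : cn (f z - p) <= t by lra.
apply/eqP; rewrite -subr_eq0 -/(d z); apply/negP => /negP dz0.
have wz : f z != z by rewrite -subr_eq0.
have [|c /cdif_d hc] := fd z; first by lra.
have [_ ] := diff_quotient_bound t0 di dM zt2 hc wt'.
rewrite diff_quotientE // cnM cnV.
have -> : d (f z) - d z = - (2 * d z) by rewrite /d ff; [ring | lra].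
rewrite -/(d z) cnN cnM cn_natr mulfK ?cn_eq0 //.
by have -> : 4 * (t / 16) / t = 1 / 4; [field; rewrite gt_eqF | lra].
Qed.

End MaximumPrinciple.

(** * Derivatives of holomorphic functions *)

Section Derivative.
Variable R : realType.
Local Notation C := R[i].
Implicit Types (f g : C -> C) (p z w : C) (r : R).

(** The supremum of h - K n serves as the limit of h where n tends to 0. *)
Lemma real_limit (T : Type) (P : set T) (x0 : T) (h n : T -> R) (K : R) :
  0 <= K -> P x0 -> (forall u v, P u -> P v -> h u - h v <= K * (n u + n v)) ->
  exists c, forall u, P u -> `|h u - c| <= K * n u.
Proof.
move=> K0 P0 hh; pose A := [set h u - K * n u | u in P].
have ub v : P v -> ubound A (h v + K * n v).
  by move=> Pv _ [u Pu <-]; have := hh u v Pu Pv; lra.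
exists (sup A) => u Pu; rewrite ler_norml; apply/andP; split.
  have : h u - K * n u <= sup A.
    by apply: ub_le_sup; [exists (h x0 + K * n x0); exact: ub | exists u].
  have : sup A <= h u + K * n u.
    by apply: ge_sup; [exists (h x0 - K * n x0), x0 | exact: ub].
  lra.
have : h u - K * n u <= sup A.
  by apply: ub_le_sup; [exists (h x0 + K * n x0); exact: ub | exists u].
lra.
Qed.

Lemma complex_limit f p r (K : R) : 0 < r -> 0 <= K ->
  (forall u v, 0 < cn (u - p) < r -> 0 < cn (v - p) < r ->
     cn (f u - f v) <= K * (cn (u - p) + cn (v - p))) ->
  exists c, forall u, 0 < cn (u - p) < r -> cn (f u - c) <= 2 * K * cn (u - p).
Proof.
move=> r0 K0 hf; pose P := [set u : C | 0 < cn (u - p) < r].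
pose x0 : C := p + (r / 2)%:C.
have Px0 : P x0.
  by rewrite /P /= addrAC subrr add0r cn_real gtr0_norm; lra.
have [|a ha] := @real_limit _ P x0 (fun u => re (f u)) (fun u => cn (u - p)) K K0 Px0.
  move=> u v Pu Pv; apply: le_trans (hf u v Pu Pv); rewrite -reB.
  exact: le_trans (ler_norm _) (re_le_cn _).
have [|b hb] := @real_limit _ P x0 (fun u => im (f u)) (fun u => cn (u - p)) K K0 Px0.
  move=> u v Pu Pv; apply: le_trans (hf u v Pu Pv); rewrite -imB.
  exact: le_trans (ler_norm _) (im_le_cn _).
exists (pt a b) => u Pu; apply: le_trans (cn_le_reim _) _.
rewrite reB imB re_pt im_pt.
by have := ha u Pu; have := hb u Pu; lra.
Qed.

(** Third divided differences are bounded, by three applications of the maximum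
    principle, so second divided differences are Lipschitz in each argument. The
    difference quotient of the derivative at p is the sum f[u, u, p] + f[p, p, u]
    of second divided differences, and so it has a limit as u tends to p. *)
Lemma derivative_cdif f (f' : C -> C) p r : 0 < r ->
  (forall z, cn (z - p) < r -> cdif f z (f' z)) -> exists c, cdif f' p c.
Proof.
move=> r0 fd; pose q := r / 2.
have q0 : 0 < q by rewrite divr_gt0.
have qr : q < r by rewrite /q; lra.
have fi z : cn (z - p) <= q -> near_holo f z.
  move=> hz; apply: (@cdif_near_holo _ _ _ (r - q)); first by lra.
  move=> v hv; exists (f' v); apply: fd.
  by apply: le_lt_trans (cn_trans _ z _) _; lra.
have [z0 [_ fM _]] := disc_max_re (ltW q0) (fun w hw => near_holo_cont (fi w hw)).
set M := cn (f z0) in fM.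
pose B := [set z : C | cn (z - p) <= q / 2].
have Bq z : B z -> cn (z - p) <= q by rewrite /B /=; have := cn_ge0 (z - p); lra.
have fB z : B z -> cdif f z (f' z) by move=> /Bq hz; apply: fd; lra.
pose D1 b := diff_quotient f b (f' b).
have D1b b : B b -> forall z, cn (z - p) <= q -> near_holo (D1 b) z /\ cn (D1 b z) <= 4 * M / q.
  by move=> hb; apply: diff_quotient_bound => //; exact: fB.
(* e1 chooses a derivative of D1 b at c, with a dummy value unless b and c are
   distinct points of B. *)
have D1d b c : exists d, B b -> B c -> c != b -> cdif (D1 b) c d.
  have [[hb [hc cb]]|n] := pselect (B b /\ B c /\ c != b); last first.
    by exists 0 => hb hc cb; case: n.
  by have [d hd] := cdif_diff_quotient (f' b) cb (fB c hc); exists d.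
pose e1 b c := projT1 (cid (D1d b c)).
have he1 b c : B b -> B c -> c != b -> cdif (D1 b) c (e1 b c).
  by rewrite /e1; case: cid.
pose D2 b c := diff_quotient (D1 b) c (e1 b c).
pose M2 := 4 * (4 * M / q) / q.
have D2b b c : B b -> B c -> c != b ->
    forall z, cn (z - p) <= q -> near_holo (D2 b c) z /\ cn (D2 b c z) <= M2.
  move=> hb hc cb; apply: diff_quotient_bound => //; last exact: he1.
    by move=> z /(D1b b hb)[].
  by move=> z /(D1b b hb)[].
pose M3 := 4 * M2 / q.
have M30 : 0 <= M3.
  have M0 : 0 <= M by exact: cn_ge0.
  by rewrite /M3 /M2 !(mulr_ge0, invr_ge0) // ltW.
have D3 b c d z : B b -> B c -> B d -> c != b -> d != b -> d != c -> B z ->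
    cn (D2 b c z - D2 b c d) <= M3 * cn (z - d).
  move=> hb hc hd cb db dc hz.
  have [k hk] := cdif_diff_quotient (e1 b c) dc (he1 b d hb hd db).
  have [->|zd] := eqVneq z d.
    by rewrite subrr cn0 mulr_ge0 ?cn_ge0.
  have h2 w : cn (w - p) <= q -> near_holo (D2 b c) w by move=> /(D2b b c hb hc cb)[].
  have h3 w : cn (w - p) <= q -> cn (D2 b c w) <= M2 by move=> /(D2b b c hb hc cb)[].
  have [_] := diff_quotient_bound q0 h2 h3 hd hk (Bq z hz).
  by rewrite diff_quotientE // cnM cnV ler_pdivrMr // cn_gt0 subr_eq0.
have D2E b c z : c != b -> z != b -> z != c ->
    D2 b c z = ((f z - f b) / (z - b) - (f c - f b) / (c - b)) / (z - c).
  by move=> cb zb zc; rewrite /D2 diff_quotientE // /D1 !diff_quotientE.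
have D2bb b c : c != b -> D2 b c b = (f' b - (f c - f b) / (c - b)) / (b - c).
  by move=> cb; rewrite /D2 diff_quotientE 1?eq_sym // /D1 diff_quotient_eq diff_quotientE.
have Bp : B p by rewrite /B /= subrr cn0 divr_ge0 // ltW.
pose F u := (f' u - f' p) / (u - p).
have FE u : u != p -> F u = D2 u p u + D2 p u p.
  move=> up; have pu : p != u by rewrite eq_sym.
  by rewrite !D2bb // /F; field; rewrite !subr_eq0 up pu.
have [|||c hc] := @complex_limit F p (q / 2) (3 * M3); first by rewrite divr_gt0.
  by rewrite mulr_ge0.
  move=> u v /andP[u0 ub] /andP[v0 vb].
  have up : u != p by rewrite -subr_eq0 -cn_gt0.
  have vp : v != p by rewrite -subr_eq0 -cn_gt0.
  have pu : p != u by rewrite eq_sym.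
  have pv : p != v by rewrite eq_sym.
  have Bu : B u by exact: ltW.
  have Bv : B v by exact: ltW.
  have [<-|uv] := eqVneq u v.
    by rewrite subrr cn0 mulr_ge0 ?addr_ge0 ?cn_ge0 // mulr_ge0.
  have vu : v != u by rewrite eq_sym.
  have E1 := D3 u p v u Bu Bp Bv pu vu vp Bu.
  have E2 := D3 v p u v Bv Bp Bu pv uv up Bv.
  have E3 := D3 p u v p Bp Bu Bv up vp vu Bp.
  have E4 := D3 p v u p Bp Bv Bu vp up uv Bp.
  have S1 : D2 u p v = D2 v p u.
    by rewrite !D2E //; field; rewrite !subr_eq0 ?up ?vp ?pu ?pv ?uv ?vu.
  have S2 : D2 p u v = D2 p v u.
    by rewrite !D2E //; field; rewrite !subr_eq0 ?up ?vp ?pu ?pv ?uv ?vu.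
  rewrite !FE //.
  have -> : D2 u p u + D2 p u p - (D2 v p v + D2 p v p) =
    (D2 u p u - D2 u p v) - (D2 v p v - D2 v p u) +
    ((D2 p u p - D2 p u v) - (D2 p v p - D2 p v u)) by rewrite S1 S2; ring.
  apply: le_trans (cnD _ _) _; apply: le_trans (lerD (cnB _ _) (cnB _ _)) _.
  rewrite (cnBC v u) (cnBC p v) (cnBC p u) in E2 E3 E4.
  have T : M3 * cn (u - v) <= M3 * (cn (u - p) + cn (v - p)).
    by apply: ler_wpM2l => //; rewrite (cnBC v p) cn_trans.
  lra.
exists c => e e0; pose N := 2 * (3 * M3).
have N1 : 0 < N + 1 by rewrite ltr_wpDl // mulr_ge0 // mulr_ge0.
exists (Num.min (q / 2) (e / (N + 1))) => [|w].
  by rewrite lt_min divr_gt0 //= divr_gt0.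
rewrite lt_min => /andP[h1]; rewrite ltr_pdivlMr // => h2.
have [->|wp] := eqVneq w p.
  by rewrite !subrr mulr0 subrr cn0 mulr0.
have wp0 : 0 < cn (w - p) by rewrite cn_gt0 subr_eq0.
have -> : f' w - f' p - c * (w - p) = (F w - c) * (w - p).
  by rewrite /F mulrBl divfK // subr_eq0.
rewrite cnM ler_wpM2r ?cn_ge0 //; apply: le_trans (hc w _) _; first by rewrite wp0 h1.
by rewrite -/N; lra.
Qed.

End Derivative.

(** * Holomorphic functions on a Riemann surface *)

Section Surface.
Variables (R : realType) (S : riemannSurface R).
Local Notation C := R[i].
Local Notation idx := (rs_index S).
Implicit Types (x y : S) (i j : idx) (f g : S -> Cplx R).

Lemma chart_nbhs i x (P : set S) : chart_dom (rs_chart i) x -> nbhs x P ->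
  exists2 r : R, 0 < r & forall w : C, cn (w - rs_chart i x) < r ->
    [/\ chart_dom (rs_chart i) (chart_inv (rs_chart i) w),
        rs_chart i (chart_inv (rs_chart i) w) = w &
        P (chart_inv (rs_chart i) w)].
Proof.
move=> xi xP; set c := rs_chart i.
have cx : (c @` chart_dom c) (c x) by exists x.
have h1 : nbhs (c x) (chart_inv c @^-1` P).
  have := chart_inv_continuous (mem_set cx).
  by rewrite /continuous_at (chart_mapK (mem_set xi)) => /(_ P xP).
have h2 : nbhs (c x) (c @` chart_dom c).
  by apply: open_nbhs_nbhs; split => //; exact: chart_codom_open.
have [r1 r10 hr1] := (proj1 (nbhs_cn _ _)) h1.
have [r2 r20 hr2] := (proj1 (nbhs_cn _ _)) h2.
exists (Num.min r1 r2) => [|w]; first by rewrite lt_min r10.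
rewrite lt_min => /andP[/hr1 Pw /hr2[y yc yw]].
by rewrite -yw chart_mapK ?inE //; split => //; move: Pw; rewrite /= -yw chart_mapK ?inE.
Qed.

Lemma nbhs_chart i x (r : R) : chart_dom (rs_chart i) x -> 0 < r ->
  nbhs x [set y | chart_dom (rs_chart i) y /\ cn (rs_chart i y - rs_chart i x) < r].
Proof.
move=> xi r0; apply: (@filterI S (nbhs x)).
  by apply: open_nbhs_nbhs; split => //; exact: chart_dom_open.
apply: (chart_map_continuous (mem_set xi) (t := [set w : Cplx R | cn (w - rs_chart i x) < r])).
by apply/nbhs_cn; exists r.
Qed.

Lemma transition_cdif i j x : chart_dom (rs_chart i) x -> chart_dom (rs_chart j) x ->
  exists c : C, cdif (rs_chart j \o chart_inv (rs_chart i)) (rs_chart i x) c.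
Proof.
by move=> xi xj; eexists; apply: derivable_cdif; exact: rs_compatible.
Qed.

(** Every chart is tested, as in [holomorphic_on]; one suffices, by
    [holo_at_chart]. *)
Definition holo_at f x := forall i, chart_dom (rs_chart i) x ->
  exists c : C, cdif (f \o chart_inv (rs_chart i)) (rs_chart i x) c.

Lemma holomorphic_onP (U : set S) f :
  holomorphic_on U f <-> forall x, U x -> holo_at f x.
Proof.
split=> h.
  by move=> x Ux i xi; eexists; apply: derivable_cdif; exact: h.
by move=> i x Ux xi; have [c /cdif_derivable[]] := h x Ux i xi.
Qed.

Lemma holo_at_chart i x f c : chart_dom (rs_chart i) x ->
  cdif (f \o chart_inv (rs_chart i)) (rs_chart i x) c -> holo_at f x.
Proof.
move=> xi fc j xj; have [d hd] := transition_cdif xj xi.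
have inv_x : chart_inv (rs_chart j) (rs_chart j x) = x by rewrite chart_mapK ?inE.
have xiN : nbhs x (chart_dom (rs_chart i)).
  by apply: open_nbhs_nbhs; split => //; exact: chart_dom_open.
have [r r0 hr] := chart_nbhs xj xiN.
exists (c * d); apply: (@near_cdif _ (fun w =>
  (f \o chart_inv (rs_chart i)) ((rs_chart i \o chart_inv (rs_chart j)) w)) _ _ _ r r0).
  by move=> w /hr[_ _ wi] /=; rewrite chart_mapK ?inE.
by apply: cdif_comp hd _; rewrite /= inv_x.
Qed.

Lemma holo_near x f g : nbhs x [set y | f y = g y] -> holo_at f x -> holo_at g x.
Proof.
move=> fg fx i xi; have [c hc] := fx i xi.
have [r r0 hr] := chart_nbhs xi fg.
by exists c; apply: near_cdif r0 _ hc => w /hr[].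
Qed.

Lemma holo_cst x (k : C) : holo_at (fun=> k) x.
Proof. by move=> i _; exists 0; exact: cdif_cst. Qed.

Lemma holoM x f g : holo_at f x -> holo_at g x -> holo_at (fun y => f y * g y) x.
Proof.
move=> fx gx i xi; have [c hc] := fx i xi; have [d hd] := gx i xi.
by eexists; exact: cdifM hc hd.
Qed.

Lemma holoV x f : f x != 0 -> holo_at f x -> holo_at (fun y => (f y)^-1) x.
Proof.
move=> f0 fx i xi; have [c hc] := fx i xi.
eexists; apply: cdifV hc; rewrite /= chart_mapK ?inE //.
Qed.

Lemma holoD x f g : holo_at f x -> holo_at g x -> holo_at (fun y => f y + g y) x.
Proof.
move=> fx gx i xi; have [c hc] := fx i xi; have [d hd] := gx i xi.
by eexists; exact: cdifD hc hd.
Qed.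

Lemma holo_chart i x : chart_dom (rs_chart i) x -> holo_at (rs_chart i) x.
Proof. by move=> xi j xj; exact: transition_cdif. Qed.

Lemma holo_nbhs_cn x f (r : R) : 0 < r -> holo_at f x ->
  nbhs x [set y | cn (f y - f x) < r].
Proof.
move=> r0 fx; have [i xi] := rs_cover x.
have [c /cdif_cont hc] := fx i xi.
have [d d0 hd] := hc _ (divr_gt0 r0 (ltr0n R 2 : (0:R) < 2)).
apply: filterS (nbhs_chart xi d0) => y [yi /hd] /=.
by rewrite !chart_mapK ?inE // => h; apply: le_lt_trans h _; lra.
Qed.

Lemma holo_neq0 x f : f x != 0 -> holo_at f x -> nbhs x [set y | f y != 0].
Proof.
move=> f0 fx; have r0 : 0 < cn (f x) by rewrite cn_gt0.
apply: filterS (holo_nbhs_cn r0 fx) => y /=.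
by apply: contraTneq => ->; rewrite sub0r cnN ltxx.
Qed.

Lemma holo_map_cdif (h : S -> S) i j x : holomorphic_map h ->
  chart_dom (rs_chart i) x -> chart_dom (rs_chart j) (h x) ->
  exists c : C, cdif (rs_chart j \o h \o chart_inv (rs_chart i)) (rs_chart i x) c.
Proof.
by move=> [_ hh] xi xj; eexists; apply: derivable_cdif; exact: hh.
Qed.

Lemma holo_comp (h : S -> S) f x : holomorphic_map h -> holo_at f (h x) ->
  holo_at (f \o h) x.
Proof.
move=> hh fx i xi; have [j xj] := rs_cover (h x).
have [d hd] := holo_map_cdif hh xi xj; have [c hc] := fx j xj.
have hjN : nbhs x (h @^-1` chart_dom (rs_chart j)).
  by apply: hh.1; apply: open_nbhs_nbhs; split => //; exact: chart_dom_open.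
have [r r0 hr] := chart_nbhs xi hjN.
exists (c * d); apply: (@near_cdif _ (fun w =>
  (f \o chart_inv (rs_chart j)) ((rs_chart j \o h \o chart_inv (rs_chart i)) w)) _ _ _ r r0).
  by move=> w /hr[_ _ wi] /=; rewrite chart_mapK ?inE.
by apply: cdif_comp hd _; rewrite /= chart_mapK ?inE.
Qed.

Lemma holo_map_id : holomorphic_map (@id S).
Proof. by split=> [x //|i j x]; exact: rs_compatible. Qed.

Lemma holo_map_comp (h k : S -> S) : holomorphic_map h -> holomorphic_map k ->
  holomorphic_map (k \o h).
Proof.
move=> hh hk; split.
  by move=> x; apply: continuous_comp; [exact: hh.1 | exact: hk.1].
move=> i j x xi xj.
have [|c /cdif_derivable[] //] := @holo_comp h (rs_chart j \o k) x hh _ i xi.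
by apply: holo_comp => //; exact: holo_chart.
Qed.

(** A disc about a point near x0, where f vanishes locally, still contains x0. *)
Lemma identity_near (U : set S) f x0 : open U -> U x0 ->
  (forall x, U x -> holo_at f x) ->
  closure [set x | nbhs x [set y | f y = 0]] x0 -> nbhs x0 [set y | f y = 0].
Proof.
move=> oU Ux0 fU cl; have [i xi] := rs_cover x0.
have [r r0 hr] := chart_nbhs xi (open_nbhs_nbhs (conj oU Ux0)).
have r20 : 0 < r / 2 by rewrite divr_gt0.
have [y [yz [yi hy]]] := cl _ (nbhs_chart xi r20).
have [s s0 hs] := chart_nbhs yi yz.
have H := @identity_disc _ (f \o chart_inv (rs_chart i)) (rs_chart i y) s (r / 2) s0.
have t0 : 0 < r / 2 - cn (rs_chart i y - rs_chart i x0) by lra.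
apply: filterS (nbhs_chart xi t0) => u [ui hu] /=.
have -> : f u = (f \o chart_inv (rs_chart i)) (rs_chart i u) by rewrite /= chart_mapK ?inE.
apply: H.
  move=> w hw; have [|wi ww wU] := hr w.
    by apply: le_lt_trans (cn_trans _ (rs_chart i y) _) _; lra.
  by have := fU _ wU i wi; rewrite ww.
  by move=> w /hs[].
by apply: le_lt_trans (cn_trans _ (rs_chart i x0) _) _; rewrite (cnBC (rs_chart i x0)); lra.
Qed.

Lemma connected_ind (A : set S) : connected [set: S] -> open A -> closed A ->
  A !=set0 -> forall x, A x.
Proof.
move=> cS oA cA A0 x; have := cS A A0.
have AE : A = [set: S] `&` A by rewrite setTI.
by move=> -> //; [exists A | exists A].
Qed.

(** The set where f takes the value at a point of maximal modulus is closed, and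
    open by the strong maximum principle. *)
Lemma compact_holo_cst f : compact [set: S] -> connected [set: S] ->
  (forall x, holo_at f x) -> exists c : C, forall x, f x = c.
Proof.
move=> cS kS fh.
have [[x0 _]|n] := pselect (exists x : S, True); last first.
  by exists 0 => x; case: n; exists x.
pose G (x : S) : R := cn (f x).
have Gc : continuous G.
  move=> x; apply/cvgrPdist_lt => e e0.
  apply: filterS (holo_nbhs_cn e0 (fh x)) => y /=.
  apply: le_lt_trans; rewrite /G ler_norml lerNl opprB.
  by rewrite cn_lerB cnBC cn_lerB.
have T0 : [set: S] !=set0 by exists x0.
have [p _ pmax] := compact_EVT_max T0 cS (continuous_subspaceT Gc).
exists (f p); apply: (@connected_ind [set x | f x = f p]) => //; last by exists p.
  rewrite openE => x /= fx; have [i xi] := rs_cover x.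
  have [r r0 hr] := chart_nbhs xi (filterT : nbhs x setT).
  have r20 : 0 < r / 2 by rewrite divr_gt0.
  rewrite /interior /=; apply: filterS (nbhs_chart xi r20) => y [yi hy] /=.
  have [->//|yx] := eqVneq y x.
  pose F := f \o chart_inv (rs_chart i).
  have F0 : F (rs_chart i x) = f p by rewrite /F /= chart_mapK ?inE.
  have q0 : 0 < cn (rs_chart i y - rs_chart i x).
    rewrite cn_gt0 subr_eq0; apply: contraNneq yx => e.
    by rewrite -(chart_mapK (mem_set yi)) e chart_mapK ?inE.
  have pd : punctured_holo F (rs_chart i x) (cn (rs_chart i y - rs_chart i x)).
    split; first by have [c /cdif_cont] := fh x i xi.
    move=> z /andP[_ hz]; have [|zi zz _] := hr z; first by lra.
    by have := fh _ i zi; rewrite zz.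
  have Fy : F (rs_chart i y) = f y by rewrite /F /= chart_mapK ?inE.
  rewrite -Fy -F0; apply: (strong_max q0 pd) => // z _; rewrite F0.
  by apply: pmax; rewrite inE.
move=> x cl /=; apply/eqP; rewrite -subr_eq0; apply/negP => /negP n0.
have [y [/= ye]] := cl _ (holo_neq0 n0 (holoD (fh x) (holo_cst (- f p)))).
by rewrite /= ye subrr eqxx.
Qed.

End Surface.

(** * Derivatives of maps in charts *)

Section ChartDerivative.
Variables (R : realType) (S : riemannSurface R).
Local Notation C := R[i].
Local Notation ch i := (rs_chart (r := S) i).
Implicit Types (h k : S -> S) (x : S).

Lemma cdif_unique (f : C -> C) z c d : cdif f z c -> cdif f z d -> c = d.
Proof. by move=> /cdif_derivable[_ <-] /cdif_derivable[_ <-]. Qed.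

(** For h the identity this is the transition function of the canonical bundle. *)
Definition chart_deriv h (i j : rs_index S) (x : S) : Cplx R :=
  derive1 (ch j \o h \o chart_inv (ch i) : Cplx R -> Cplx R) (ch i x).

Lemma chart_derivP h i j x : holomorphic_map h ->
  chart_dom (ch i) x -> chart_dom (ch j) (h x) ->
  cdif (ch j \o h \o chart_inv (ch i)) (ch i x) (chart_deriv h i j x).
Proof. by move=> [_ hh] xi xj; apply: derivable_cdif; exact: hh. Qed.

Lemma chart_deriv_comp h k i j l x : holomorphic_map h -> holomorphic_map k ->
  chart_dom (ch i) x -> chart_dom (ch j) (h x) -> chart_dom (ch l) (k (h x)) ->
  chart_deriv (k \o h) i l x = chart_deriv k j l (h x) * chart_deriv h i j x.
Proof.
move=> hh hk xi xj xl.
have hjN : nbhs x (h @^-1` chart_dom (ch j)).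
  by apply: hh.1; apply: open_nbhs_nbhs; split => //; exact: chart_dom_open.
have [r r0 hr] := chart_nbhs xi hjN.
apply: cdif_unique (chart_derivP (holo_map_comp hh hk) xi xl) _.
apply: (@near_cdif _ (fun w => (ch l \o k \o chart_inv (ch j))
  ((ch j \o h \o chart_inv (ch i)) w)) _ _ _ r r0).
  by move=> w /hr[_ _ wi] /=; rewrite chart_mapK ?inE.
apply: cdif_comp; first exact: chart_derivP.
have -> : (ch j \o h \o chart_inv (ch i)) (ch i x) = ch j (h x).
  by rewrite /= chart_mapK ?inE.
exact: chart_derivP.
Qed.

Lemma chart_deriv_id i x : chart_dom (ch i) x -> chart_deriv id i i x = 1.
Proof.
move=> xi; have [r r0 hr] := chart_nbhs xi (filterT : nbhs x setT).
apply: cdif_unique (chart_derivP (@holo_map_id R S) xi xi) _.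
by apply: near_cdif r0 _ (cdif_id _) => w /hr[_ ww _] /=; rewrite ww.
Qed.

Lemma chart_deriv_neq0 h i j x : automorphism h ->
  chart_dom (ch i) x -> chart_dom (ch j) (h x) -> chart_deriv h i j x != 0.
Proof.
move=> [hh [k [hk kh hk']]] xi xj.
have xi' : chart_dom (ch i) (k (h x)) by rewrite hk.
have := chart_deriv_comp hh hk' xi xj xi'.
have -> : k \o h = id by apply/funext => y /=; rewrite hk.
rewrite chart_deriv_id // => e; apply: contra_eq_neq e => ->.
by rewrite mulr0 oner_neq0.
Qed.

Lemma holo_chart_deriv h i j x : holomorphic_map h ->
  chart_dom (ch i) x -> chart_dom (ch j) (h x) -> holo_at (chart_deriv h i j) x.
Proof.
move=> hh xi xj.
have hjN : nbhs x (h @^-1` chart_dom (ch j)).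
  by apply: hh.1; apply: open_nbhs_nbhs; split => //; exact: chart_dom_open.
have [r r0 hr] := chart_nbhs xi hjN.
pose F : Cplx R -> Cplx R := ch j \o h \o chart_inv (ch i).
have [w hw|c hc] := @derivative_cdif _ F (fun w => derive1 F w) (ch i x) r r0.
  have [wi ww wj] := hr w hw.
  by have := chart_derivP hh wi wj; rewrite /chart_deriv ww.
apply: (holo_at_chart (c := c) xi).
by apply: near_cdif r0 _ hc => w /hr[_ ww _] /=; rewrite /chart_deriv ww.
Qed.

Lemma map_eq_near h (x0 : S) : continuous h -> closure [set x | nbhs x [set y | h y = y]] x0 ->
  h x0 = x0.
Proof.
move=> hc cl; apply: (rs_hausdorff (p := h x0) (q := x0)) => A B hA hB.
have [y [/= yy [Ay By]]] := cl _ (filterI (hc x0 _ hA : nbhs x0 (h @^-1` A)) hB).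
have hy : h y = y by exact: nbhs_singleton yy.
by exists y; split => //; move: Ay; rewrite /= hy.
Qed.

(** The interior of the set of fixed points is closed: h fixes its limit points by
    separation, and the identity theorem applies to the difference of h and the
    identity in a chart about such a point. *)
Lemma holo_map_identity h (x0 : S) : connected [set: S] -> holomorphic_map h ->
  nbhs x0 [set y | h y = y] -> h = id.
Proof.
move=> cS hh h0; apply/funext => z /=.
suff : nbhs z [set y | h y = y] by exact: nbhs_singleton.
apply: (@connected_ind R S [set x | nbhs x [set y | h y = y]]) => //.
  exact: open_interior.
  move=> x cl /=; have hx := map_eq_near hh.1 cl.
  have [j xj] := rs_cover x; have xj' : chart_dom (ch j) (h x) by rewrite hx.
  pose U := chart_dom (ch j) `&` h @^-1` chart_dom (ch j).
  have oU : open U.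
    apply: openI; first exact: chart_dom_open.
    by apply: open_comp (chart_dom_open _) => y _; exact: hh.1.
  have Ux : U x by split.
  pose f y : Cplx R := ch j (h y) + (-1) * ch j y.
  have fU y : U y -> holo_at f y.
    move=> [yj hyj]; apply: holoD; first by apply: (holo_comp hh); exact: holo_chart.
    by apply: holoM; [exact: holo_cst | exact: holo_chart].
  have clf : closure [set x | nbhs x [set y | f y = 0]] x.
    move=> B hB; have [u [/= hu Bu]] := cl _ hB; exists u; split => //=.
    by apply: filterS hu => v /= hv; rewrite /f hv; ring.
  have := identity_near oU Ux fU clf.
  have := open_nbhs_nbhs (conj oU Ux) : nbhs x U.
  move=> h1 h2; apply: filterS (filterI h1 h2) => v [[vj hvj] /=].
  rewrite /f mulN1r => /eqP; rewrite subr_eq0 => /eqP e.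
  by rewrite -(chart_mapK (mem_set hvj)) e chart_mapK ?inE.
by exists x0.
Qed.

(** The derivative squares to 1; if it were 1, h would be the identity near x. *)
Lemma involution_tangent h i (x : S) : connected [set: S] -> automorphism h ->
  h \o h = id -> h x = x -> h <> id -> chart_dom (ch i) x ->
  chart_deriv h i i x = -1.
Proof.
move=> cS ah hh2 hx hid xi; have hh := ah.1.
have hhK y : h (h y) = y by rewrite -[LHS]/((h \o h) y) hh2.
have xi' : chart_dom (ch i) (h x) by rewrite hx.
have xi2 : chart_dom (ch i) (h (h x)) by rewrite hhK.
have := chart_deriv_comp hh hh xi xi' xi2; rewrite hh2 chart_deriv_id // hx => /esym/eqP.
rewrite -expr2 sqrf_eq1 => /orP[/eqP d1|/eqP //]; case: hid.
have hiN : nbhs x (h @^-1` chart_dom (ch i)).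
  by apply: hh.1; apply: open_nbhs_nbhs; split => //; exact: chart_dom_open.
have [r r0 hr] := chart_nbhs xi hiN.
pose F : C -> C := ch i \o h \o chart_inv (ch i).
have Fp : F (ch i x) = ch i x by rewrite /F /= chart_mapK ?inE // hx.
have [||||s s0 hs] := @involution_id _ F (ch i x) r r0.
  move=> w /hr[wi ww wj]; exists (chart_deriv h i i (chart_inv (ch i) w)).
  by have := chart_derivP hh wi wj; rewrite ww.
  exact: Fp.
  by rewrite -d1; exact: chart_derivP.
  by move=> w /hr[wi ww wj]; rewrite /F /= (chart_mapK (mem_set wj)) hhK.
apply: (@holo_map_identity h x) => //.
apply: filterS (filterI hiN (nbhs_chart xi s0)) => y [/= hyi [yi /hs]].
rewrite /F /= (chart_mapK (mem_set yi)) => e.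
by rewrite -(chart_mapK (mem_set hyi)) e chart_mapK ?inE.
Qed.

End ChartDerivative.

(** * Groups, involutions and dimensions *)

Lemma perfect_hom_trivial (G : groupType) (K : fieldType) (chi : G -> K) :
  perfect G -> (forall x y, chi (x * y)%g = chi x * chi y) -> chi 1%g = 1 ->
  forall x, chi x = 1.
Proof.
move=> pG cM c1 x.
have cV y : chi y * chi y^-1%g = 1 by rewrite -cM mulgV.
have : derived_subgroup G x by rewrite pG.
move=> /(_ [pred y | chi y == 1]) H; apply/eqP; apply: H.
  split; first by rewrite inE c1.
  move=> y z; rewrite !inE => /eqP cy /eqP cz.
  by rewrite cM cy mul1r; have := cV z; rewrite cz mul1r => ->.
move=> y z; rewrite inE /commg /conjg !cM.
by rewrite (mulrCA (chi z^-1%g)) (mulrC (chi z^-1%g)) cV mulr1 mulrC cV.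
Qed.

Lemma aut_subgroup_id (R : realType) (S : riemannSurface R) (G : groupType)
  (rho : G -> S -> S) : aut_subgroup rho -> rho 1%g = id.
Proof.
move=> [aG rhoM _]; have [_ [k [hk _ _]]] := aG 1%g; apply/funext => y.
have := congr1 (fun f => k (f y)) (rhoM 1%g 1%g).
by rewrite mulg1 /= !hk => <-.
Qed.

(** Linearly independent families in A have independent coordinate vectors in B,
    so their size is bounded by d, and a maximal one is a basis. *)
Lemma has_dim_inj (K : fieldType) (V W : lmodType K) (A : set V) (B : set W)
    (f : V -> W) d :
  (forall n (a : 'I_n -> K) (u : 'I_n -> V),
     f (\sum_k a k *: u k) = \sum_k a k *: f (u k)) ->
  (forall n (a : 'I_n -> K) (u : 'I_n -> V), (forall k, A (u k)) ->
     A (\sum_k a k *: u k)) ->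
  (forall v, A v -> B (f v)) -> (forall v, A v -> f v = 0 -> v = 0) ->
  has_dim B d -> exists n, has_dim A n.
Proof.
move=> fcomb Acomb fAB finj [e [_ _ espan]].
pose indep m := exists2 u : 'I_m -> V, forall k, A (u k) &
  forall a : 'I_m -> K, \sum_k a k *: u k = 0 -> forall k, a k = 0.
have indep_le m : indep m -> (m <= d)%N.
  move=> [u uA ufree].
  pose c k := projT1 (cid (espan _ (fAB _ (uA k)))).
  have cP k : f (u k) = \sum_l c k l *: e l by rewrite /c; case: cid.
  pose X := \matrix_(k < m, l < d) c k l.
  suff : row_free X by rewrite /row_free => /eqP <-; exact: rank_leq_col.
  apply: inj_row_free => v vX; apply/rowP => k; rewrite mxE.
  apply: (ufree (fun k => v 0 k)); apply: finj; first exact: Acomb.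
  rewrite fcomb.
  under eq_bigr => i _ do rewrite cP scaler_sumr.
  rewrite exchange_big big1 // => l _.
  under eq_bigr => i _ do rewrite scalerA.
  rewrite -scaler_suml.
  have := congr1 (fun M : 'rV_d => M 0 l) vX; rewrite !mxE => vX0.
  by rewrite (_ : \sum_i _ = 0) ?scale0r // -[RHS]vX0; apply: eq_bigr => i _; rewrite mxE.
have ex0 : exists m, `[< indep m >].
  by exists 0%N; apply/asboolP; exists (fun _ => 0) => [[]|a _ []].
have le0 m : `[< indep m >] -> (m <= d)%N by move/asboolP/indep_le.
have [m /asboolP[u uA ufree] mmax] := ex_maxnP ex0 le0.
exists m, u; split => // v vA; apply: contrapT => nspan.
suff /asboolP/mmax : indep m.+1 by rewrite ltnn.
pose w (k : 'I_m.+1) := if unlift ord0 k is Some j then u j else v.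
exists w => [k|a]; first by rewrite /w; case: unlift.
rewrite big_ord_recl {1}/w unlift_none.
under eq_bigr => i _ do rewrite /w liftK.
move=> a0; have av : a ord0 = 0.
  apply/eqP; apply/negP => /negP an; apply: nspan.
  exists (fun k => - ((a ord0)^-1 * a (lift ord0 k))).
  move/eqP: a0; rewrite addr_eq0 => /eqP a0.
  rewrite -[v]scale1r -(mulVf an) -scalerA a0 scalerN scaler_sumr -sumrN.
  by apply: eq_bigr => k _; rewrite scalerA scaleNr.
move: a0; rewrite av scale0r add0r => /ufree a0 k.
by case: (unliftP ord0 k) => [j ->|-> //]; exact: a0.
Qed.

(** The points that s moves form pairs, so an even number of points is fixed. *)
Lemma even_involution (I : finType) (s : I -> I) (o : I) : involutive s -> s o = o ->
  ~~ odd #|I| -> exists2 k, k != o & s k = k.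
Proof.
move=> ss so ev; apply: contrapT => nex.
have only k : s k = k -> k = o.
  by move=> sk; apply/eqP; apply: contrapT => /negP ko; apply: nex; exists k.
pose A := [set k | (enum_rank k < enum_rank (s k))%N]%SET.
pose B := [set k | (enum_rank (s k) < enum_rank k)%N]%SET.
have sA : s @: A = B.
  apply/setP => k; rewrite inE; apply/imsetP/idP => [[j]|kB].
    by rewrite inE => jA ->; rewrite ss.
  by exists (s k); rewrite ?ss // inE ss.
have cAB : #|A| = #|B| by rewrite -sA card_imset //; exact: inv_inj.
have : (#|A| + #|B| + 1 = #|I|)%N.
  rewrite -cardsUI (_ : A :&: B = finset.set0) ?cards0 ?addn0; last first.
    by apply/setP => k; rewrite !inE ltnNge andbC; case: ltngtP.
  have -> : A :|: B = [set~ o]%SET.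
    apply/setP => k; rewrite !inE -neq_ltn.
    apply/idP/idP; apply: contra => /eqP e; apply/eqP.
      by rewrite e so.
    by apply: only; apply: enum_rank_inj; apply: val_inj.
  by rewrite cardsC1 addn1 prednK //; apply/card_gt0P; exists o.
by move=> cI; move: ev; rewrite -cI cAB addnn addn1 /= odd_double.
Qed.

Lemma even_isotropy_involution (G : groupType) (H : set G) (c : nat) :
  H 1%g -> (forall h, H h -> H h^-1%g) -> H #= `I_c -> ~~ odd c ->
  exists h, [/\ H h, h <> 1%g & (h * h = 1)%g].
Proof.
move=> H1 HV /card_set_bijP[f [fH finj fsurj]] ev.
have finjE h k : H h -> H k -> f h = f k -> h = k.
  by move=> Hh Hk; apply: finj; rewrite inE.
have ex (k : 'I_c) : exists h, H h /\ f h = k.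
  by have [h Hh <-] := fsurj k (ltn_ord k); exists h.
pose phi k := projT1 (cid (ex k)).
have phiP k : H (phi k) /\ f (phi k) = k by rewrite /phi; case: cid.
pose o : 'I_c := Ordinal (fH _ H1).
pose s (k : 'I_c) : 'I_c := Ordinal (fH _ (HV _ (phiP k).1)).
have phis k : phi (s k) = (phi k)^-1%g.
  by apply: finjE; [exact: (phiP _).1 | exact: HV (phiP k).1 | exact: (phiP _).2].
have phio : phi o = 1%g by apply: finjE; [exact: (phiP _).1 | | exact: (phiP _).2].
have phi_inj k l : phi k = phi l -> k = l.
  by move=> e; apply: val_inj; rewrite /= -(phiP k).2 e (phiP l).2.
have [||//|k ko sk] := @even_involution _ s o.
by move=> k; apply: phi_inj; rewrite !phis invgK.
by apply: phi_inj; rewrite phis phio invg1.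
by rewrite card_ord.
exists (phi k); split; first exact: (phiP k).1.
  by rewrite -phio => /phi_inj/eqP; rewrite (negbTE ko).
by rewrite -{1}sk phis mulVg.
Qed.

(** * Lifts of automorphisms to a theta characteristic *)

Lemma canon_mul_algebra (K : comPzRingType) (m p q G G' : K) :
  G * G' = 1 -> m * p * q = m * G ^+ 2 * (G' * p) * (G' * q).
Proof.
move=> e; transitivity (m * p * q * (G * G') ^+ 2); last by ring.
by rewrite e expr1n mulr1.
Qed.

Lemma sq_ratio_algebra (K : comPzRingType) (m D ca mj gg lp cb mp lm gi : K) :
  gg * lp = lm * gi -> cb * mp = m * gi ^+ 2 ->
  m * D * (ca * (mj * gg ^+ 2) * lp ^+ 2) = mp * (cb * (D * ca)) * (mj * lm ^+ 2).
Proof.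
move=> e1 e2; transitivity (m * D * ca * mj * (gg * lp) ^+ 2); first by ring.
transitivity ((cb * mp) * D * ca * mj * lm ^+ 2); last by ring.
by rewrite e1 e2; ring.
Qed.

Lemma ratio_algebra (K : comPzRingType) (gj gi l L l' L' : K) :
  gj * l = L * gi -> gj * l' = L' * gi ->
  gi * (gj * (l' * L)) = gi * (gj * (L' * l)).
Proof.
move=> e1 e2; transitivity ((gj * l') * (L * gi)); first by ring.
by rewrite e2 -e1; ring.
Qed.

Section Lifts.
Variables (R : realType) (S : riemannSurface R) (L : bundle S).
Local Notation C := R[i].
Local Notation ch i := (rs_chart (r := S) i).
Local Notation U := (lb_dom L).
Local Notation g := (lb_trans L).
Hypothesis (LL : holomorphic_line_bundle L).
Variable mu : lb_index L -> rs_index S -> S -> Cplx R.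
Hypothesis mu_holo : forall i a x, U i x -> chart_dom (ch a) x -> holo_at (mu i a) x.
Hypothesis mu_neq0 : forall i a x, U i x -> chart_dom (ch a) x -> mu i a x != 0.
Hypothesis mu_trans : forall i k a b x, U i x -> U k x ->
  chart_dom (ch a) x -> chart_dom (ch b) x ->
  chart_deriv id b a x * mu i a x = mu k b x * g k i x ^+ 2.
Hypotheses (S_compact : compact [set: S]) (S_connected : connected [set: S]).
Implicit Types (h : S -> S) (x : S) (lam : lb_index L -> lb_index L -> S -> Cplx R).

Let U_open i : open (U i). Proof. by case: LL. Qed.
Let U_cover x : exists i, U i x. Proof. by case: LL. Qed.
Let g_neq0 i j x : U i x -> U j x -> g i j x != 0.
Proof. by case: LL => _ _ _ + _; apply. Qed.
Let g_mul i j l x : U i x -> U j x -> U l x -> g i j x * g j l x = g i l x.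
Proof. by case: LL => _ _ _ _; apply. Qed.

Lemma trans_holo i j x : U i x -> U j x -> holo_at (g i j) x.
Proof. by case: LL => _ _ h _ _ Ui Uj; move/holomorphic_onP: (h i j); apply. Qed.

Lemma trans_refl i x : U i x -> g i i x = 1.
Proof.
move=> Ui; apply: (mulfI (g_neq0 Ui Ui)); by rewrite g_mul // mulr1.
Qed.

(** An index of a trivialisation around each point. It turns gluing data into plain
    functions of the point; independence of the choice is proved where needed. *)
Definition triv (x : S) : lb_index L := projT1 (cid (U_cover x)).

Lemma trivP x : U (triv x) x. Proof. by rewrite /triv; case: cid. Qed.

(** An isomorphism from h^*L to L, in trivialisations. *)
Definition bundle_lift h lam := [/\
  forall i j x, U i (h x) -> U j x -> holo_at (lam i j) x,
  forall i j x, U i (h x) -> U j x -> lam i j x != 0 &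
  forall i k j l x, U i (h x) -> U k (h x) -> U j x -> U l x ->
    g l j x * lam i j x = lam k l x * g k i (h x)].

(** The square of lam is the pullback of differentials by h, when mu identifies
    L^2 with the canonical bundle. *)
Definition root_lift h lam := bundle_lift h lam /\
  forall i j a b x, U i (h x) -> U j x ->
    chart_dom (ch a) x -> chart_dom (ch b) (h x) ->
    mu i b (h x) * chart_deriv h a b x = mu j a x * lam i j x ^+ 2.

Lemma nbhs_dom i x : U i x -> nbhs x (U i).
Proof. by move=> Ui; apply: open_nbhs_nbhs. Qed.

Lemma nbhs_preim_dom h i x : holomorphic_map h -> U i (h x) -> nbhs x (h @^-1` U i).
Proof. by move=> hh Ui; apply: hh.1; exact: nbhs_dom. Qed.

Lemma nbhs_chart_dom a x : chart_dom (ch a) x -> nbhs x (chart_dom (ch a)).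
Proof. by move=> xa; apply: open_nbhs_nbhs; split => //; exact: chart_dom_open. Qed.

(** The pullback of differentials by h divided by the square of lam, in
    trivialisations i, j and charts a, b. *)
Definition sq_ratio h lam i j a b x : C :=
  mu i b (h x) * chart_deriv h a b x / (mu j a x * lam i j x ^+ 2).

Lemma sq_ratio_indep h lam i j a b i' j' a' b' x :
  holomorphic_map h -> bundle_lift h lam ->
  U i (h x) -> U j x -> chart_dom (ch a) x -> chart_dom (ch b) (h x) ->
  U i' (h x) -> U j' x -> chart_dom (ch a') x -> chart_dom (ch b') (h x) ->
  sq_ratio h lam i j a b x = sq_ratio h lam i' j' a' b' x.
Proof.
move=> hh [_ l0 lt] Ui Uj xa xb Ui' Uj' xa' xb'.
have E1 := lt i' i j' j x Ui' Ui Uj' Uj.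
have E2 := mu_trans Uj' Uj xa' xa.
have E3 := mu_trans Ui' Ui xb' xb.
have id_h := @holo_map_id R S.
have E4 : chart_deriv h a' b' x =
   chart_deriv id b b' (h x) * (chart_deriv h a b x * chart_deriv id a' a x).
  rewrite -[LHS]/(chart_deriv (id \o (h \o id)) a' b' x).
  rewrite (chart_deriv_comp (holo_map_comp id_h hh) id_h xa' xb xb').
  by rewrite (chart_deriv_comp id_h hh xa' xa xb).
have E5 : chart_deriv id a' a x * chart_deriv id a a' x = 1.
  by rewrite -(chart_deriv_comp id_h id_h xa xa' xa) chart_deriv_id.
have E6 : mu j' a' x = chart_deriv id a' a x * (mu j a x * g j j' x ^+ 2).
  by rewrite -E2 mulrA E5 mul1r.
rewrite /sq_ratio; apply/eqP; rewrite eqr_div; last 2 first.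
  by rewrite mulf_neq0 ?mu_neq0 // expf_neq0 // l0.
  by rewrite mulf_neq0 ?mu_neq0 // expf_neq0 // l0.
apply/eqP; rewrite E4 E6.
exact: sq_ratio_algebra E1 E3.
Qed.

Lemma holo_sq_ratio h lam i j a b x : holomorphic_map h -> bundle_lift h lam ->
  U i (h x) -> U j x -> chart_dom (ch a) x -> chart_dom (ch b) (h x) ->
  holo_at (sq_ratio h lam i j a b) x.
Proof.
move=> hh [lh l0 _] Ui Uj xa xb; apply: holoM.
  apply: holoM; last exact: holo_chart_deriv.
  by apply: (holo_comp hh); exact: mu_holo.
apply: holoV; first by rewrite mulf_neq0 ?mu_neq0 // expf_neq0 // l0.
apply: holoM; first exact: mu_holo.
by apply: holoM; exact: lh.
Qed.

Lemma root_lift_exists h lam : automorphism h -> bundle_lift h lam ->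
  exists lam', root_lift h lam'.
Proof.
move=> ah hl; have hh := ah.1.
(* Q collects the local expressions of sq_ratio into one global function. *)
pose cc x := projT1 (cid (rs_cover x)).
have ccP x : chart_dom (ch (cc x)) x by rewrite /cc; case: cid.
pose Q x : Cplx R := sq_ratio h lam (triv (h x)) (triv x) (cc x) (cc (h x)) x.
have QE i j a b x : U i (h x) -> U j x -> chart_dom (ch a) x -> chart_dom (ch b) (h x) ->
  sq_ratio h lam i j a b x = Q x.
  by move=> *; apply: sq_ratio_indep => //; exact: trivP.
have Qh x : holo_at Q x.
  have U1 := trivP (h x); have U2 := trivP x.
  apply: holo_near (holo_sq_ratio hh hl U1 U2 (ccP x) (ccP (h x))).
  apply: filterS (filterI (filterI (nbhs_preim_dom hh U1) (nbhs_dom U2))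
    (filterI (nbhs_chart_dom (ccP x)) (hh.1 x _ (nbhs_chart_dom (ccP (h x)))))).
  by move=> y [[y1 y2] [y3 y4]] /=; apply: QE.
have [c cQ] := compact_holo_cst S_compact S_connected Qh.
have [lh l0 lt] := hl.
exists (fun i j x => sqrtc c * lam i j x).
have cE i j a b x : U i (h x) -> U j x -> chart_dom (ch a) x -> chart_dom (ch b) (h x) ->
  mu i b (h x) * chart_deriv h a b x = c * (mu j a x * lam i j x ^+ 2).
  move=> Ui Uj xa xb; rewrite -(cQ x) -(QE i j a b x) // /sq_ratio divfK //.
  by rewrite mulf_neq0 ?mu_neq0 // expf_neq0 // l0.
split; last first.
  by move=> i j a b x Ui Uj xa xb; rewrite (cE i j a b) // exprMn sqr_sqrtc mulrCA.
split.
  by move=> i j x Ui Uj; apply: holoM; [exact: holo_cst | exact: lh].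
  move=> i j x Ui Uj; rewrite mulf_neq0 ?l0 // sqrtc_eq0.
  have [a xa] := rs_cover x; have [b xb] := rs_cover (h x).
  have := cE i j a b x Ui Uj xa xb; apply: contra_eq_neq => ->.
  by rewrite mul0r mulf_neq0 ?mu_neq0 // chart_deriv_neq0.
by move=> i k j l x Ui Uk Uj Ul; rewrite mulrCA (lt i k) // mulrA.
Qed.

(** The ratio of two normalised lifts is a global holomorphic function of square 1. *)
Lemma root_lift_unique h lam lam' : holomorphic_map h ->
  root_lift h lam -> root_lift h lam' ->
  exists e : C, e ^+ 2 = 1 /\ forall i j x, U i (h x) -> U j x -> lam' i j x = e * lam i j x.
Proof.
move=> hh [[lh l0 lt] lsq] [[lh' l0' lt'] lsq'].
pose q i j x : Cplx R := lam' i j x * (lam i j x)^-1.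
pose Q x : Cplx R := q (triv (h x)) (triv x) x.
have QE i j x : U i (h x) -> U j x -> q i j x = Q x.
  move=> Ui Uj; have Ui' := trivP (h x); have Uj' := trivP x.
  rewrite /Q /q; set i' := triv (h x) in Ui' *; set j' := triv x in Uj' *.
  have E1 := lt i i' j j' x Ui Ui' Uj Uj'; have E2 := lt' i i' j j' x Ui Ui' Uj Uj'.
  have gj := g_neq0 Uj' Uj; have gi := g_neq0 Ui' Ui.
  have n1 := l0 i j x Ui Uj; have n2 := l0 i' j' x Ui' Uj'.
  apply/eqP; rewrite eqr_div //; apply/eqP; apply: (mulfI gj); apply: (mulfI gi).
  exact: ratio_algebra E1 E2.
have Qh x : holo_at Q x.
  have U1 := trivP (h x); have U2 := trivP x.
  apply: (@holo_near _ _ _ (q (triv (h x)) (triv x))); last first.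
    by apply: holoM; [exact: lh' | apply: holoV; [exact: l0 | exact: lh]].
  apply: filterS (filterI (nbhs_preim_dom hh U1) (nbhs_dom U2)).
  by move=> y [y1 y2] /=; apply: QE.
have [c cQ] := compact_holo_cst S_compact S_connected Qh.
have cE i j x : U i (h x) -> U j x -> lam' i j x = c * lam i j x.
  by move=> Ui Uj; rewrite -(cQ x) -(QE i j x) // /q divfK // l0.
have [[x0 _]|n] := pselect (exists x : S, True); last first.
  by exists 1; split=> [|i j x]; [rewrite expr1n | case: n; exists x].
exists c; split => //.
have U1 := trivP (h x0); have U2 := trivP x0.
have [a xa] := rs_cover x0; have [b xb] := rs_cover (h x0).
have := lsq' _ _ _ _ _ U1 U2 xa xb; rewrite (lsq _ _ _ _ _ U1 U2 xa xb) cE // exprMn.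
have n1 := mu_neq0 U2 xa; have n2 : lam (triv (h x0)) (triv x0) x0 ^+ 2 != 0.
  by rewrite expf_neq0 // l0.
move=> /(mulfI n1) /eqP; rewrite -subr_eq0 -{1}[_ ^+ 2]mul1r -mulrBl mulf_eq0 (negbTE n2) orbF.
by rewrite subr_eq0 => /eqP.
Qed.

Definition lift_comp h lam lam' (i j : lb_index L) (x : S) : Cplx R :=
  lam (triv (h x)) j x * lam' i (triv (h x)) (h x).

Lemma lift_compE h k lam lam' i j m x : bundle_lift h lam -> bundle_lift k lam' ->
  U i (k (h x)) -> U m (h x) -> U j x ->
  lift_comp h lam lam' i j x = lam m j x * lam' i m (h x).
Proof.
move=> [_ _ lt] [_ _ lt'] Ui Um Uj; have Un := trivP (h x); rewrite /lift_comp.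
set n := triv (h x) in Un *.
have := lt m n j j x Um Un Uj Uj; rewrite trans_refl // mul1r => ->.
have := lt' i i m n (h x) Ui Ui Um Un; rewrite (trans_refl Ui) mulr1 => <-.
by rewrite mulrA.
Qed.

Lemma root_lift_comp h k lam lam' : holomorphic_map h -> holomorphic_map k ->
  root_lift h lam -> root_lift k lam' -> root_lift (k \o h) (lift_comp h lam lam').
Proof.
move=> hh hk [hl lsq] [hl' lsq'].
have [lh l0 lt] := hl; have [lh' l0' lt'] := hl'.
split; last first.
  move=> i j a b x Ui Uj xa xb; have Um := trivP (h x).
  have [c xc] := rs_cover (h x).
  rewrite (chart_deriv_comp hh hk xa xc xb) mulrA (lsq' _ _ _ _ _ Ui Um xc xb).
  by rewrite mulrAC (lsq _ _ _ _ _ Um Uj xa xc) /lift_comp exprMn [RHS]mulrA.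
split.
  move=> i j x Ui Uj; have Um := trivP (h x).
  apply: (@holo_near _ _ _ (fun y => lam (triv (h x)) j y * lam' i (triv (h x)) (h y))).
    have hi : nbhs x (h @^-1` (k @^-1` U i)).
      by apply: hh.1; exact: nbhs_preim_dom.
    apply: filterS (filterI hi (filterI (nbhs_preim_dom hh Um) (nbhs_dom Uj))).
    by move=> y [y1 [y2 y3]] /=; rewrite -(lift_compE hl hl' y1 y2 y3).
  apply: holoM; first exact: lh.
  by apply: (holo_comp hh); exact: lh'.
  by move=> i j x Ui Uj; rewrite mulf_neq0 ?l0 ?l0' //; exact: trivP.
move=> i i' j j' x Ui Ui' Uj Uj'; have Um := trivP (h x).
rewrite /lift_comp; set m := triv (h x) in Um *.
rewrite mulrA (lt m m j j' x Um Um Uj Uj') trans_refl // mulr1 -!mulrA; congr (_ * _).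
by have := lt' i i' m m (h x) Ui Ui' Um Um; rewrite trans_refl // mul1r.
Qed.

Definition lift_id (i j : lb_index L) (x : S) : Cplx R := g j i x.

Lemma root_lift_id : root_lift id lift_id.
Proof.
rewrite /lift_id; split; last first.
  by move=> i j a b x Ui Uj xa xb; rewrite mulrC; apply: mu_trans.
split.
  by move=> i j x Ui Uj; exact: trans_holo.
  by move=> i j x Ui Uj; exact: g_neq0.
by move=> i k j l x Ui Uk Uj Ul; rewrite !g_mul.
Qed.

Local Notation V := (lb_index L -> S -> Cplx R : lmodType R[i]).

Let scaleVE (c : C) (s : V) j x : (c *: s) j x = c * s j x. Proof. by []. Qed.
Let addVE (s t : V) j x : (s + t) j x = s j x + t j x. Proof. by []. Qed.

(** The lift acts by pulling sections back along h and multiplying by lam, so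
    composition is contravariant. *)
Definition act h lam (s : V) : V := fun j x =>
  if `[< U j x >] then lam (triv (h x)) j x * s (triv (h x)) (h x) else 0.

Lemma act_in h lam s j x : U j x ->
  act h lam s j x = lam (triv (h x)) j x * s (triv (h x)) (h x).
Proof. by rewrite /act => /asboolT ->. Qed.

Lemma actE h lam s i j x : bundle_lift h lam -> sections L s ->
  U i (h x) -> U j x -> act h lam s j x = lam i j x * s i (h x).
Proof.
move=> [_ _ lt] [_ st _] Ui Uj; have Ut := trivP (h x); rewrite act_in //.
rewrite (st _ i _ Ut Ui) mulrA; congr (_ * _).
by rewrite -(lt i (triv (h x)) j j x Ui Ut Uj Uj) trans_refl // mul1r.
Qed.

Lemma act_sections h lam s : holomorphic_map h -> bundle_lift h lam ->
  sections L s -> sections L (act h lam s).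
Proof.
move=> hh hl sL; have [sh st s0] := sL; have [lh _ lt] := hl; split.
move=> j; apply/holomorphic_onP => x Uj; have Ui := trivP (h x).
  apply: (@holo_near _ _ _ (fun y => lam (triv (h x)) j y * s (triv (h x)) (h y))).
    apply: filterS (filterI (nbhs_preim_dom hh Ui) (nbhs_dom Uj)) => y [y1 y2] /=.
    by rewrite -(actE hl sL y1 y2).
  apply: holoM; first exact: lh.
  apply: (@holo_comp R S h (s (triv (h x)))) => //.
  by have /holomorphic_onP := sh (triv (h x)); apply.
move=> i j x Ui Uj; have Ut := trivP (h x); rewrite !(actE hl sL Ut) // mulrA.
  by rewrite (lt (triv (h x)) (triv (h x)) j i) // trans_refl // mulr1.
by move=> i x /asboolF; rewrite /act => ->.
Qed.

Lemma act_comp h k lam lam' s :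
  act h lam (act k lam' s) = act (k \o h) (lift_comp h lam lam') s.
Proof.
apply/funext => j; apply/funext => x; rewrite /act; case: asboolP => // Uj.
by rewrite (asboolT (trivP (h x))) /lift_comp mulrA.
Qed.

Lemma act_id s : sections L s -> act id lift_id s = s.
Proof.
move=> [_ st s0]; apply/funext => j; apply/funext => x; rewrite /act.
case: asboolP => [Uj|/s0 //]; by rewrite /lift_id -st //; exact: trivP.
Qed.

Lemma act_proportional h lam lam' (e : C) s :
  (forall i j x, U i (h x) -> U j x -> lam' i j x = e * lam i j x) ->
  act h lam' s = e *: act h lam s.
Proof.
move=> le; apply/funext => j; apply/funext => x.
rewrite scaleVE /act; case: asboolP => [Uj|_]; last by rewrite mulr0.
by rewrite (le _ _ _ (trivP (h x)) Uj) -mulrA.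
Qed.

Lemma act_comb h lam n (a : 'I_n -> C) (e : 'I_n -> V) :
  act h lam (\sum_k a k *: e k) = \sum_k a k *: act h lam (e k).
Proof.
have D u v : act h lam (u + v) = act h lam u + act h lam v.
  apply/funext => j; apply/funext => x; rewrite addVE /act.
  by case: asboolP => _; rewrite ?addr0 // addVE mulrDr.
have Z c u : act h lam (c *: u) = c *: act h lam u.
  apply/funext => j; apply/funext => x; rewrite scaleVE /act.
  by case: asboolP => _; rewrite ?mulr0 // scaleVE mulrCA.
have O : act h lam 0 = 0 by rewrite -[X in act _ _ X](scale0r (0 : V)) Z scale0r.
by rewrite (big_morph _ D O); apply: eq_bigr => k _; rewrite Z.
Qed.

Section Basis.
Variables (n : nat) (e : 'I_n -> V).
Hypothesis e_in : forall k, sections L (e k).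
Hypothesis e_free : forall a : 'I_n -> C, \sum_k a k *: e k = 0 -> forall k, a k = 0.
Hypothesis e_span : forall v, sections L v -> exists a : 'I_n -> C, v = \sum_k a k *: e k.

(** Row k of M holds the coordinates of the image of e k. *)
Definition act_mx h lam (M : 'M[C]_n) := forall k, act h lam (e k) = \sum_l M k l *: e l.

Lemma act_mx_exists h lam : holomorphic_map h -> bundle_lift h lam -> exists M, act_mx h lam M.
Proof.
move=> hh hl.
have H k := e_span (act_sections hh hl (e_in k)).
pose m k := projT1 (cid (H k)).
have hm k : act h lam (e k) = \sum_l m k l *: e l by rewrite /m; case: cid.
exists (\matrix_(k, l) m k l) => k; rewrite hm.
by apply: eq_bigr => l _; rewrite mxE.
Qed.

Lemma basis_mx_inj (M N : 'M[C]_n) :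
  (forall k, \sum_l M k l *: e l = \sum_l N k l *: e l) -> M = N.
Proof.
move=> MN; apply/matrixP => k l; apply/eqP; rewrite -subr_eq0; apply/eqP.
apply: (e_free (a := fun l => M k l - N k l)).
have -> : \sum_l (M k l - N k l) *: e l = \sum_l M k l *: e l - \sum_l N k l *: e l.
  by rewrite -sumrB; apply: eq_bigr => i _; rewrite scalerBl.
by rewrite MN subrr.
Qed.

Lemma act_mx_comp h k lam lam' M M' : act_mx h lam M -> act_mx k lam' M' ->
  act_mx (k \o h) (lift_comp h lam lam') (M' *m M).
Proof.
move=> hM hM' i; rewrite -act_comp hM' act_comb.
under eq_bigr => l _ do rewrite hM scaler_sumr.
rewrite exchange_big /=; apply: eq_bigr => m _; rewrite mxE scaler_suml.
by apply: eq_bigr => l _; rewrite scalerA.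
Qed.

Lemma act_mx_id : act_mx id lift_id 1%:M.
Proof.
move=> k; rewrite act_id // (bigD1 k) //= mxE eqxx scale1r big1 ?addr0 // => l lk.
by rewrite mxE eq_sym (negbTE lk) scale0r.
Qed.

Lemma act_mx_sign h lam lam' M M' : holomorphic_map h ->
  root_lift h lam -> root_lift h lam' -> act_mx h lam M -> act_mx h lam' M' ->
  \det M' ^+ 2 = \det M ^+ 2.
Proof.
move=> hh hl hl' hM hM'; have [c [c2 lc]] := root_lift_unique hh hl hl'.
have -> : M' = c *: M.
  apply: basis_mx_inj => k; rewrite -hM' (act_proportional (e := c) _ lc) hM scaler_sumr.
  by apply: eq_bigr => l _; rewrite mxE scalerA.
by rewrite detZ exprMn -exprM mulnC exprM c2 expr1n mul1r.
Qed.

(** The square of the lift is a normalised lift of the identity, hence a constant,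
    and at the fixed point x this constant is the derivative of h, which is -1. *)
Lemma det_involution_lift h lam M x : automorphism h -> h \o h = id -> h x = x ->
  h <> id -> root_lift h lam -> act_mx h lam M -> \det M ^+ 2 = (-1) ^+ n.
Proof.
move=> ah hh2 hx hid hl hM; have hh := ah.1.
have hl2 := root_lift_comp hh hh hl hl; rewrite hh2 in hl2.
have hM2 := act_mx_comp hM hM; rewrite hh2 in hM2.
have [c [_ lc]] := root_lift_unique (@holo_map_id R S) root_lift_id hl2.
have Ut := trivP x; have [a xa] := rs_cover x.
have cN : c = -1.
  have := lc _ _ _ Ut Ut; rewrite /lift_comp /lift_id hx trans_refl // mulr1 => <-.
  have [_ lsq] := hl; have := lsq (triv x) (triv x) a a x; rewrite hx.
  move=> /(_ Ut Ut xa xa); rewrite involution_tangent // => E.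
  by apply: (mulfI (mu_neq0 Ut xa)); rewrite -expr2 E.
have -> : \det M ^+ 2 = \det (M *m M) by rewrite det_mulmx expr2.
have -> : M *m M = (-1)%:M.
  apply: basis_mx_inj => k; rewrite -hM2 (act_proportional _ lc) cN.
  rewrite (act_mx_id k) scaler_sumr; apply: eq_bigr => l _.
  by rewrite scalerA !mxE mulrnAr mulr1.
by rewrite det_scalar.
Qed.

(** Squared determinants of normalised lifts do not see signs, so they form a
    homomorphism on G, trivial by perfectness. *)
Lemma perfect_lift_even (G : groupType) (rho : G -> S -> S) (h0 : G) (x0 : S) :
  aut_subgroup rho -> (forall t : G, exists lam, bundle_lift (rho t) lam) -> perfect G ->
  (h0 * h0 = 1)%g -> h0 <> 1%g -> rho h0 x0 = x0 -> ~~ odd n.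
Proof.
move=> [aG rhoM rhoI] ex pG h02 h01 hx.
have rho1 := aut_subgroup_id (And3 aG rhoM rhoI).
have exl t : exists lam, root_lift (rho t) lam.
  by have [lam] := ex t; exact: root_lift_exists.
pose lam t := projT1 (cid (exl t)).
have lamP t : root_lift (rho t) (lam t) by rewrite /lam; case: cid.
have exM t := act_mx_exists (aG t).1 (lamP t).1.
pose M t := projT1 (cid (exM t)).
have MP t : act_mx (rho t) (lam t) (M t) by rewrite /M; case: cid.
pose chi t : C := \det (M t) ^+ 2.
have chi1 : chi 1%g = 1.
  have := lamP 1%g; have := MP 1%g; rewrite rho1 => m1 l1.
  rewrite /chi (act_mx_sign (@holo_map_id R S) root_lift_id l1 act_mx_id m1).
  by rewrite det1 expr1n.
have chiM t u : chi (t * u)%g = chi t * chi u.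
  have hh := (aG (t * u)%g).1; have := lamP (t * u)%g; have := MP (t * u)%g.
  rewrite rhoM in hh *; move=> mtu ltu.
  have := act_mx_sign hh (root_lift_comp (aG u).1 (aG t).1 (lamP u) (lamP t)) ltu
    (act_mx_comp (MP u) (MP t)) mtu.
  by rewrite /chi => ->; rewrite det_mulmx exprMn.
have := perfect_hom_trivial pG chiM chi1 h0.
have rr : rho h0 \o rho h0 = id by rewrite -rhoM h02.
have rn : rho h0 <> id by rewrite -rho1 => /rhoI.
rewrite /chi (det_involution_lift (aG h0) rr hx rn (lamP h0) (MP h0)).
rewrite -signr_odd; case: (odd n) => // /eqP.
by rewrite expr1 eq_sym -subr_eq0 opprK -[1 + 1]/(2%:R) pnatr_eq0.
Qed.

End Basis.

(** The product of two sections of L, as a differential. *)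
Definition canon_mul (s t : V) : rs_index S -> S -> Cplx R := fun a x =>
  if `[< chart_dom (ch a) x >] then
    mu (triv x) a x * s (triv x) x * t (triv x) x
  else 0.

Lemma canon_mulE s t i a x : sections L s -> sections L t -> U i x ->
  chart_dom (ch a) x -> canon_mul s t a x = mu i a x * s i x * t i x.
Proof.
move=> [_ st _] [_ tt _] Ui xa; have Uk := trivP x.
rewrite /canon_mul asboolT // (st i (triv x)) // (tt i (triv x)) //.
have := mu_trans Ui Uk xa xa; rewrite chart_deriv_id // mul1r => ->.
have := g_mul Uk Ui Uk; rewrite trans_refl // => E.
exact: canon_mul_algebra E.
Qed.

Lemma canon_mul_sections s t : sections L s -> sections L t ->
  sections (canonical_bundle S) (canon_mul s t).
Proof.
move=> sL tL; split.
move=> a; apply/holomorphic_onP => x /= xa; have Ui := trivP x.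
  apply: (@holo_near _ _ _ (fun y => mu (triv x) a y * s (triv x) y * t (triv x) y)).
    apply: filterS (filterI (nbhs_dom Ui) (nbhs_chart_dom xa)) => y [y1 y2] /=.
    by rewrite -(canon_mulE sL tL y1 y2).
  have [sh _ _] := sL; have [th _ _] := tL.
  apply: holoM; last by have /holomorphic_onP := th (triv x); apply.
  apply: holoM; last by have /holomorphic_onP := sh (triv x); apply.
  exact: mu_holo.
move=> a b x /= xa xb; have Uk := trivP x.
  rewrite -[derive1 _ _]/(chart_deriv id a b x).
  rewrite !(canon_mulE sL tL Uk) // !mulrA; congr (_ * _ * _).
  by rewrite (mu_trans Uk Uk xb xa) trans_refl // expr1n mulr1.
by move=> a x /asboolF; rewrite /canon_mul => ->.
Qed.

(** Near a point where s is not 0 the section t vanishes, and the identity theorem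
    spreads this over the connected surface. *)
Lemma canon_mul_inj s t : sections L s -> sections L t -> s != 0 ->
  canon_mul s t = 0 -> t = 0.
Proof.
move=> sL tL s0 st0; have [sh str sz] := sL; have [th ttr tz] := tL.
have [i [x0 six]] : exists i x, s i x != 0.
  apply: contrapT => n; move/negP: s0; apply; apply/eqP.
  apply/funext => i; apply/funext => x; apply/eqP; apply: contrapT => /negP h.
  by apply: n; exists i, x.
have Ui : U i x0 by apply: contrapT => /sz h; move: six; rewrite h eqxx.
have st j y : U j y -> s j y * t j y = 0.
  move=> Uj; have [a ya] := rs_cover y.
  have := canon_mulE sL tL Uj ya; rewrite st0 -mulrA => /esym/eqP.
  by rewrite mulf_eq0 (negbTE (mu_neq0 Uj ya)) => /eqP.
pose z y := t (triv y) y.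
have zt j y : U j y -> (z y = 0) <-> (t j y = 0).
  move=> Uj; have Uk := trivP y; rewrite /z; split => h.
    by rewrite (ttr j (triv y)) // h mulr0.
  by rewrite (ttr (triv y) j) // h mulr0.
suff H x : nbhs x [set y | z y = 0].
  apply/funext => j; apply/funext => y.
  have [Uj|/tz //] := pselect (U j y).
  by apply/(zt j y Uj); have := nbhs_singleton (H y).
apply: (@connected_ind R S [set x | nbhs x [set y | z y = 0]]) => //.
exact: open_interior.
move=> y cl; have Uj := trivP y; set j := triv y in Uj.
  have th' u : U j u -> holo_at (t j) u by have /holomorphic_onP := th j; apply.
  have clj : closure [set u | nbhs u [set v | t j v = 0]] y.
    move=> B hB; have [u [/= zu [Bu Uu]]] := cl _ (filterI hB (nbhs_dom Uj)).
    exists u; split => //=; apply: filterS (filterI zu (nbhs_dom Uu)) => v [zv Uv] /=.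
    exact/(zt j v Uv).
  have := identity_near (U_open j) Uj th' clj => h.
  by apply: filterS (filterI h (nbhs_dom Uj)) => v [tv Uv] /=; exact/(zt j v Uv).
exists x0; have sx : holo_at (s i) x0 by have /holomorphic_onP := sh i; apply.
  apply: filterS (filterI (holo_neq0 six sx) (nbhs_dom Ui)) => y [/= sy Uy].
  by apply/(zt i y Uy)/eqP; have /eqP := st i y Uy; rewrite mulf_eq0 (negbTE sy).
Qed.

Lemma sections_comb n (a : 'I_n -> C) (u : 'I_n -> V) :
  (forall k, sections L (u k)) -> sections L (\sum_k a k *: u k).
Proof.
move=> uL; apply: (big_ind (sections L : V -> Prop)).
split.
  by move=> i; apply/holomorphic_onP => x _; exact: holo_cst.
  by move=> i j x _ _; rewrite mulr0.
  by [].
move=> s t [sh st s0] [th tt t0]; split.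
  move=> i; apply/holomorphic_onP => x Ui.
    apply: (@holoD R S x (s i) (t i)).
      by have /holomorphic_onP := sh i; apply.
    by have /holomorphic_onP := th i; apply.
  by move=> i j x Ui Uj; rewrite !addVE (st i j) // (tt i j) // mulrDr.
  by move=> i x Ui; rewrite addVE s0 // t0 // addr0.
move=> k _; have [sh st s0] := uL k; split.
  move=> i; apply/holomorphic_onP => x Ui.
    apply: (@holoM R S x (fun=> a k) (u k i)); first exact: holo_cst.
    by have /holomorphic_onP := sh i; apply.
  by move=> i j x Ui Uj; rewrite !scaleVE (st i j) // mulrCA.
  by move=> i x Ui; rewrite scaleVE s0 // mulr0.
Qed.

Lemma canon_mul_comb s n (a : 'I_n -> C) (u : 'I_n -> V) :
  canon_mul s (\sum_k a k *: u k) =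
  \sum_k a k *: (canon_mul s (u k) : rs_index S -> S -> Cplx R : lmodType C).
Proof.
pose W := (rs_index S -> S -> Cplx R : lmodType C).
have D v w : canon_mul s (v + w) = (canon_mul s v : W) + canon_mul s w.
  apply/funext => b; apply/funext => x.
  rewrite -[RHS]/(canon_mul s v b x + canon_mul s w b x) /canon_mul.
  by case: asboolP => _; rewrite ?addr0 // addVE mulrDr.
have Z c v : canon_mul s (c *: v) = c *: (canon_mul s v : W).
  apply/funext => b; apply/funext => x.
  rewrite -[RHS]/(c * canon_mul s v b x) /canon_mul.
  by case: asboolP => _; rewrite ?mulr0 // scaleVE mulrCA.
have O : canon_mul s 0 = (0 : W).
  by rewrite -[X in canon_mul s X](scale0r (0 : V)) Z scale0r.
rewrite (big_morph (canon_mul s : V -> W) D O).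
by apply: eq_bigr => k _; rewrite Z.
Qed.

Lemma sections_has_dim d : genus S d -> exists n, dim_H0 L n.
Proof.
move=> Sd.
have [[s [sL s0]]|n] := pselect (exists s : V, sections L s /\ s != 0).
  pose f : V -> (rs_index S -> S -> Cplx R : lmodType C) := canon_mul s.
  apply: (has_dim_inj (f := f) _ _ _ _ Sd).
  by move=> n a u; exact: canon_mul_comb.
  exact: sections_comb.
  by move=> t; exact: canon_mul_sections.
  by move=> t tL; exact: canon_mul_inj.
exists 0%N, (fun _ => 0); split=> [[] //|a _ [] //|v vL].
exists (fun=> 0); rewrite big_ord0; apply/eqP; apply: contrapT => /negP v0.
by apply: n; exists v.
Qed.

End Lifts.

(** * The theorem *)

Theorem mainTheorem3 (R : realType) (S : riemannSurface R) (g : nat)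
    (G : groupType) (rho : G -> S -> S) (L : bundle S)
    (T : riemannSurface R) (pi : S -> T)
    (g0 r : nat) (c a b : 'I_r -> nat)
    (S_compact : compact [set: S]) (S_connected : connected [set: S])
    (S_genus : genus S g) (g_ge2 : (2 <= g)%N)
    (G_Aut : aut_subgroup rho)
    (L_theta : theta_characteristic L)
    (L_invariant : invariant_bundle rho L)
    (pi_quotient : is_quotient rho pi)
    (signature : is_signature rho pi g0 c)
    (c_decomp : forall i, c i = (2 ^ a i * b i)%N) (b_odd : forall i, odd (b i))
    (G_perfect : perfect G)
    (schur : H2 R[i] G #= `I_2)
    (g0_eq0 : g0 = 0%N)
    (A_neq0 : (\max_(i < r) a i != 0)%N)
    (A_odd : odd #|[set i : 'I_r | a i == \max_(j < r) a j]%SET|) :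
  even_theta L.
Proof.
have [LL [mu [mu_h mu_neq0 mu_trans]]] := L_theta.
have mu_holo i j x : lb_dom L i x -> chart_dom (rs_chart j) x -> holo_at (mu i j) x.
  by move=> Li xj; have /holomorphic_onP := mu_h i j; apply.
have mu_transE i k j l x : lb_dom L i x -> lb_dom L k x ->
    chart_dom (rs_chart j) x -> chart_dom (rs_chart l) x ->
    chart_deriv id l j x * mu i j x = mu k l x * lb_trans L k i x ^+ 2.
  by move=> Li Lk xj xl; exact: (mu_trans i k j l x).
have [n hn] := sections_has_dim LL mu_holo mu_neq0 mu_transE S_connected S_genus.
exists n => //; have [e [e_in e_free e_span]] := hn.
have [i ai] : exists i, a i != 0%N.
  apply: contrapT => ne; move/negP: A_neq0; apply; rewrite big1 // => i _.
  by apply/eqP; apply: contrapT => /negP ai; apply: ne; exists i.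
have ci : ~~ odd (c i) by rewrite c_decomp oddM oddX (negbTE ai).
have [_ [Q [_ _ _ isoQ]]] := signature.
have [_ pi_surj _] := pi_quotient; have [x px] := pi_surj (Q i).
have rho1 := aut_subgroup_id G_Aut.
have [_ rhoM _] := G_Aut.
have [||h [hx h1 hh]] := even_isotropy_involution _ _ (isoQ i x px) ci.
  by rewrite /isotropy /= rho1.
  move=> h; rewrite /isotropy /= => hx.
  by rewrite -{1}hx -[LHS]/((rho h^-1%g \o rho h) x) -rhoM mulVg rho1.
apply: (perfect_lift_even LL mu_holo mu_neq0 mu_transE S_compact S_connected
  e_in e_free e_span G_Aut _ G_perfect hh h1 hx).
move=> t; have [lam [l1 l2 l3]] := L_invariant t; exists lam; split.
  by move=> j k y Lj Lk; have /holomorphic_onP := l1 j k; apply.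
  exact: l2.
by move=> j k l m y *; exact: l3.
Qed.
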